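(* Let $(X,d_X,\mu)$ and $(Y,d_Y,\nu)$ be metric measure spaces and let $1\le q<\infty$. A homeomorphism $\varphi\colon X\to Y$ induces the bounded composition operator $$\varphi^{*}\colon\operatorname{Lip}(Y)\to D^{1,q}(X),\qquad \varphi^*(u)=u\circ\varphi,$$ if and only if $\varphi\in D^{1,q}(X;Y)$ in the sense of Reshetnyak. Furthermore, $$\|\varphi^{*}\|^{q}=\int_{X}|D_{q}\varphi|^{q}\,d\mu.$$
   Context: A metric measure space $(X,d_X,\mu)$ is a separable metric space $(X,d_X)$ with a nontrivial regular Borel measure $\mu$ that is finite on bounded sets. (Measures are outer measures for which Borel sets are measurable; regular Borel means every set is contained in a Borel set of the same measure.) For $1\le q<\infty$, $D^{1,q}(X)$ is the Dirichlet (homogeneous Sobolev) space of measurable functions $u\colon X\to\mathbb R$ having an upper gradient in $L^q(X,\mu)$; $|\nabla_q u|$ denotes the minimal $q$-weak upper gradient of $u$. $\operatorname{Lip}(Y)$ is the space of Lipschitz functions $u\colon Y\to\mathbb R$, and $\operatorname{Lip}(u)=\sup_{x\ne y}|u(x)-u(y)|/d_Y(x,y)$. $\varphi$ induces the bounded composition operator $\varphi^*\colon\operatorname{Lip}(Y)\to D^{1,q}(X)$ if $u\circ\varphi\in D^{1,q}(X)$ for every $u\in\operatorname{Lip}(Y)$ and there is a constant $C<\infty$ with $\big(\int_X|\nabla_q(u\circ\varphi)|^q\,d\mu\big)^{1/q}\le C\operatorname{Lip}(u)$ for all $u\in\operatorname{Lip}(Y)$; $\|\varphi^*\|$ is the smallest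 such $C$. Sobolev class in the sense of Reshetnyak: a measurable $\varphi\colon X\to Y$ is in $D^{1,q}(X;Y)$ if there is $w\in L^q(X)$ such that for every $z\in Y$ the function $[\varphi]_z(x)=d_Y(\varphi(x),z)$ belongs to $D^{1,q}(X)$ and $|\nabla_q[\varphi]_z|\le w$ $\mu$-a.e. The smallest such majorant $w$ exists and is denoted $|D_q\varphi|$. *)

(* Defs.v *)
From HB Require Import structures.
From mathcomp Require Import all_boot all_order all_algebra.
From mathcomp Require Import all_classical all_reals all_analysis.
From mathcomp Require Import measurable_realfun.

Set Implicit Arguments.
Unset Strict Implicit.
Unset Printing Implicit Defensive.

Import Order.TTheory GRing.Theory Num.Theory.
Import numFieldNormedType.Exports.

Local Open Scope classical_set_scope.
Local Open Scope ring_scope.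

(* Measurable types of the library are pointed, so the domain of integration is
   taken to be a pointed metric space; the point plays no role, and a space
   carrying a nontrivial measure is nonempty. *)
#[short(type="pmetricType")]
HB.structure Definition PointedMetric (K : numDomainType) :=
  {M of Metric K M & Pointed M}.

Section metric_notions.
Context {R : realType}.

Definition borel_set {T : topologicalType} : set (set T) := <<s @open T >>.

Definition borel_fun {T : topologicalType} (g : T -> \bar R) :=
  forall B : set (\bar R), measurable B -> borel_set (g @^-1` B).

Definition separable (T : topologicalType) :=
  exists2 D : set T, countable D & dense D.

Definition metric_bounded {T : metricType R} (A : set T) :=
  exists M : R, forall x y, A x -> A y -> mdist x y <= M.

Record is_metric_measure_space {T : metricType R}
    (mu : {outer_measure set T -> \bar R}) : Prop := IsMetricMeasureSpace {
  mms_separable : separable T ;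
  mms_borel : forall B, borel_set B -> mu.-caratheodory B ;
  mms_regular : forall A, exists B, [/\ borel_set B, A `<=` B & mu B = mu A] ;
  mms_bounded : forall A, metric_bounded A -> (mu A < +oo)%E ;
  mms_nontrivial : mu setT != 0%E }.

Definition homeomorphism {S T : topologicalType} (f : S -> T) :=
  exists g : T -> S, [/\ cancel f g, cancel g f, continuous f & continuous g].

Definition is_lipschitz {T : metricType R} (u : T -> R) :=
  exists L : R, forall x y, `|u x - u y| <= L * mdist x y.

(* sup set0 = 0, so Lip(u) = 0 on a one-point space *)
Definition lip_const {T : metricType R} (u : T -> R) : R :=
  sup [set r | exists x y : T, x != y /\ r = `|u x - u y| / mdist x y].

End metric_notions.

Section curves.
Context {R : realType} {X : metricType R}.

(* a compact curve c_fun : [c_lo, c_hi] -> X; the values of c_fun outside the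
   interval are irrelevant *)
Record curve := Curve {
  c_lo : R ;
  c_hi : R ;
  c_fun :> R -> X ;
  c_le : c_lo <= c_hi ;
  c_cont : {within `[c_lo, c_hi], continuous c_fun} }.

(* as in [variation], a partition of [a, b] is the list s of its points
   other than a *)
Definition mvariation (a b : R) (f : R -> X) (s : seq R) : R :=
  let F := f \o nth b (a :: s) in
  \sum_(0 <= n < size s) mdist (F n) (F n.+1).

Definition length_on (f : R -> X) (a b : R) : \bar R :=
  ereal_sup [set (mvariation a b f s)%:E | s in itv_partition a b].

Definition curve_length (c : curve) : \bar R := length_on c (c_lo c) (c_hi c).

Definition rectifiable (c : curve) := (curve_length c < +oo)%E.

(* The arc-length parametrization: its value at t in [0, length] is c(s) for
   any s such that c has length t on [c_lo, s]; such an s exists when c is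
   rectifiable, and c(s) does not depend on the choice of s. *)
Definition arc_length_param (c : curve) (t : R) : X :=
  c (xget (c_lo c)
       [set s | c_lo c <= s <= c_hi c /\ length_on c (c_lo c) s = t%:E]).

Definition path_integral (g : X -> \bar R) (c : curve) : \bar R :=
  \int[lebesgue_measure]_(t in `[0, fine (curve_length c)])
    g (arc_length_param c t).

Definition upper_gradient_ineq (u : X -> R) (g : X -> \bar R) (c : curve) :=
  (`|u (c (c_lo c)) - u (c (c_hi c))|%:E <= path_integral g c)%E.

Definition upper_gradient (u : X -> R) (g : X -> \bar R) :=
  [/\ borel_fun g, forall x, (0 <= g x)%E &
      forall c, rectifiable c -> upper_gradient_ineq u g c].

End curves.
Arguments curve {R} X.

(* Measurability with respect to mu is Caratheodory measurability: a complete
   sigma-algebra that contains the Borel sets of a metric measure space. *)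
Definition cara_measure {R : realType} {X : pointedType}
    (mu : {outer_measure set X -> \bar R}) :
    {measure set (caratheodory_type mu) -> \bar R} :=
  (mu : set (caratheodory_type mu) -> \bar R).

Section sobolev.
Context {R : realType} {X : pmetricType R}.
Variables (mu : {outer_measure set X -> \bar R}) (q : R).

Let XM := caratheodory_type mu.
Let muM : {measure set XM -> \bar R} := cara_measure mu.

Definition in_Lq (f : X -> \bar R) :=
  measurable_fun [set: XM] (f : XM -> \bar R) /\ ('N[muM]_(q%:E)[f] < +oo)%E.

(* curves of infinite length impose no condition on rho, so a family of
   nonrectifiable curves has modulus 0 *)
Definition admissible (G : set (curve X)) (rho : X -> \bar R) :=
  [/\ borel_fun rho, forall x, (0 <= rho x)%E &
      forall c, G c -> rectifiable c -> (1 <= path_integral rho c)%E].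

Definition modulus (G : set (curve X)) : \bar R :=
  ereal_inf [set (\int[muM]_x (rho x `^ q))%E | rho in admissible G].

Definition weak_upper_gradient (u : X -> R) (g : X -> \bar R) :=
  [/\ borel_fun g, forall x, (0 <= g x)%E &
      modulus [set c | rectifiable c /\ ~ upper_gradient_ineq u g c] = 0%E].

Definition dirichlet (u : X -> R) :=
  measurable_fun [set: XM] (u : XM -> R) /\
  exists2 g, upper_gradient u g & in_Lq g.

Definition is_min_weak_upper_gradient (u : X -> R) (g : X -> \bar R) :=
  [/\ weak_upper_gradient u g, in_Lq g &
      forall h, weak_upper_gradient u h -> in_Lq h ->
        \forall x \ae muM, (g x <= h x)%E].

(* |nabla_q u|, determined up to a mu-null set when u is in the Dirichlet
   space; the default value +oo is used only if there is no minimal gradient *)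
Definition min_weak_upper_gradient (u : X -> R) : X -> \bar R :=
  xget (cst +oo%E) [set g | is_min_weak_upper_gradient u g].

Section maps.
Context {Y : metricType R}.
Variable phi : X -> Y.

Definition composition_bound (C : R) :=
  0 <= C /\ forall u : Y -> R, is_lipschitz u ->
    ('N[muM]_(q%:E)[min_weak_upper_gradient (u \o phi)]
      <= (C * lip_const u)%:E)%E.

Definition induces_bounded_composition :=
  (forall u : Y -> R, is_lipschitz u -> dirichlet (u \o phi)) /\
  exists C, composition_bound C.

Definition composition_norm : \bar R :=
  ereal_inf [set C%:E | C in composition_bound].

Definition reshetnyak_majorant (w : X -> \bar R) :=
  [/\ in_Lq w, forall x, (0 <= w x)%E &
      forall z : Y, dirichlet (fun x => mdist (phi x) z) /\
        \forall x \ae muM,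
          (min_weak_upper_gradient (fun x => mdist (phi x) z) x <= w x)%E].

Definition reshetnyak_sobolev :=
  (forall B : set Y, borel_set B -> mu.-caratheodory (phi @^-1` B)) /\
  exists w, reshetnyak_majorant w.

Definition is_min_reshetnyak_majorant (w : X -> \bar R) :=
  reshetnyak_majorant w /\
  forall w', reshetnyak_majorant w' -> \forall x \ae muM, (w x <= w' x)%E.

(* |D_q phi|, determined up to a mu-null set when phi is in D^{1,q}(X;Y) *)
Definition reshetnyak_gradient : X -> \bar R :=
  xget (cst +oo%E) [set w | is_min_reshetnyak_majorant w].

End maps.
End sobolev.

(* Main.v *)
Require Import Defs.
From HB Require Import structures.
From mathcomp Require Import all_boot all_order all_algebra.
From mathcomp Require Import all_classical all_reals all_analysis.
From mathcomp Require Import measurable_realfun lra.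
Import Order.TTheory GRing.Theory Num.Theory.
Import numFieldNormedType.Exports.

(* Fix a dense sequence z_i in Y, let g_i be the minimal q-weak upper gradient
   of d(phi, z_i) and let w = sup_i g_i.

   Off an exceptional family of curves every increment of every d(phi, z_i)
   is bounded by the line integral of w; by density so is the distance between
   the images under phi, hence Lip(u) w is a weak upper gradient of u o phi for
   every Lipschitz u. So if w is in L^q it is the least majorant in the sense
   of Reshetnyak, and its norm is a bound for the composition operator.

   Conversely, let C be such a bound.  The sets A_i on which the i-th function
   realizes max_(i < n) g_i can be approximated from inside by closed sets, and
   as phi is a homeomorphism, by sets K_i whose images are at mutual distance
   at least 4 d.  Some 1-Lipschitz function u on Y coincides near phi(K_i) with
   s(d(., z_i)), where s is a triangle wave of height d and slope 1 or -1.  As s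
   is a local isometry, the minimal gradient h of u o phi dominates g_i on K_i,
   and summing over i bounds the integral of (max_(i < n) g_i)^q by C^q.

   Families of modulus zero are those on which the line integral of a single
   L^q function is infinite.  That a gradient may be replaced by another one on
   a Borel set where the latter works locally is proved along a curve: enlarge
   the set and its complement to open sets, at small cost for the integrals,
   and compare increments by a continuity argument.  This yields the lattice
   property, hence the existence of minimal weak upper gradients, as well as
   their locality. *)

Set Implicit Arguments.
Unset Strict Implicit.
Unset Printing Implicit Defensive.
Local Open Scope classical_set_scope.
Local Open Scope ring_scope.

(** * Length and arc-length parametrization *)

Section metric_length.
Context {R : realType} {X : metricType R}.
Implicit Types (f : R -> X) (a b c : R) (s : seq R).

Lemma mvariation_nil a b f : mvariation a b f [::] = 0.
Proof. by rewrite /mvariation big_geq. Qed.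

Lemma mvariation_cons a b f x s :
  mvariation a b f (x :: s) = mdist (f a) (f x) + mvariation x b f s.
Proof. by rewrite /mvariation /= big_nat_recl. Qed.

Lemma mvariation_cat a c b f s t : itv_partition a c s ->
  mvariation a b f (s ++ t) = mvariation a c f s + mvariation c b f t.
Proof.
elim: s a => [a /itv_partition_nil ->|x s ih a /itv_partition_cons sx] /=.
  by rewrite mvariation_nil add0r.
by rewrite !mvariation_cons ih// addrA.
Qed.

(** Inserting c into the partition only affects the one step that crosses c, and by the triangle
    inequality it does not lower the sum. *)
Lemma mvariation_split a c b f s : a <= c -> c <= b -> itv_partition a b s ->
  exists s1 s2, [/\ itv_partition a c s1, itv_partition c b s2 &
    mvariation a b f s <= mvariation a c f s1 + mvariation c b f s2].
Proof.
elim: s a => [a ac cb /itv_partition_nil ab|x s ih a ac cb].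
  have ? : c = b by apply/eqP; rewrite eq_le cb -ab.
  subst; exists [::], [::]; split; rewrite /itv_partition ?mvariation_nil ?addr0//=.
move: ac; rewrite le_eqVlt => /predU1P[->|ac] axs.
  exists [::], (x :: s); rewrite mvariation_nil add0r.
  by split => //; split => /=.
have [xs lst] := axs; case: (ltP c x) => cx.
  exists [:: c], (x :: s); split; first exact: itv_partition1.
    by move: xs => /= /andP[_ xs]; split; rewrite //= cx.
  rewrite !mvariation_cons mvariation_nil addr0 addrA lerD2r.
  exact: metric_triangle.
have [s1 [s2 [p1 p2 le12]]] := ih x cx cb (itv_partition_cons axs).
exists (x :: s1), s2; split => //.
  move: xs => /= /andP[ax _]; case: p1 => p1 l1.
  by split; rewrite //= ax.
by rewrite !mvariation_cons -addrA lerD2l.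
Qed.

Lemma length_on_ub a b f s : itv_partition a b s ->
  ((mvariation a b f s)%:E <= length_on f a b)%E.
Proof. by move=> abs; apply: ereal_sup_ubound; exists s. Qed.

Lemma mdist_length_on a b f : a <= b ->
  ((mdist (f a) (f b))%:E <= length_on f a b)%E.
Proof.
rewrite le_eqVlt => /predU1P[->|ab].
  rewrite mdistxx -(mvariation_nil b b f); apply: length_on_ub.
  by split => /=.
have := length_on_ub f (itv_partition1 ab).
by rewrite mvariation_cons mvariation_nil addr0.
Qed.

Lemma length_on_ge0 a b f : a <= b -> (0 <= length_on f a b)%E.
Proof.
by move=> ab; apply: le_trans (mdist_length_on f ab); rewrite lee_fin mdist_ge0.
Qed.

Lemma length_onD a c b f : a <= c -> c <= b ->
  (length_on f a b = length_on f a c + length_on f c b)%E.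
Proof.
move=> ac cb; apply/eqP; rewrite eq_le; apply/andP; split.
  apply: ge_ereal_sup => _ [s abs <-].
  have [s1 [s2 [p1 p2 le12]]] := mvariation_split f ac cb abs.
  apply: (@le_trans _ _ (mvariation a c f s1 + mvariation c b f s2)%:E) => //.
  by rewrite EFinD leeD// length_on_ub.
have key s1 : itv_partition a c s1 ->
    ((mvariation a c f s1)%:E + length_on f c b <= length_on f a b)%E.
  move=> p1; rewrite addeC -leeBrDr//; apply: ge_ereal_sup => _ [s2 p2 <-].
  rewrite leeBrDr// addeC -EFinD -mvariation_cat//.
  exact/length_on_ub/(itv_partition_cat p1 p2).
have cb0 := length_on_ge0 f cb.
(* Taking the supremum over partitions of [a, c] requires subtracting [length_on f c b]. If that
   length is infinite, a single partition of [a, c] already forces the length on [a, b] to be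
   infinite. *)
move: key cb0; case: (length_on f c b) => [r| |//] key cb0.
  rewrite -leeBrDr//; apply: ge_ereal_sup => _ [s1 p1 <-].
  by rewrite leeBrDr// key.
have [s1 /key] : exists s1, itv_partition a c s1.
  have [->|ac'] := eqVneq a c; first by exists [::]; split => /=.
  by exists [:: c]; apply: itv_partition1; rewrite lt_neqAle ac'.
by rewrite addey// leye_eq => /eqP ->; rewrite leey.
Qed.

Lemma length_onxx a f : length_on f a a = 0%E.
Proof.
apply/eqP; rewrite eq_le length_on_ge0// andbT.
apply: ge_ereal_sup => _ [s /itv_partitionxx -> <-].
by rewrite mvariation_nil.
Qed.

Lemma le_length_on a b c f : a <= b -> b <= c ->
  (length_on f a b <= length_on f a c)%E.
Proof. by move=> ab bc; rewrite (length_onD f ab bc) leeDl// length_on_ge0. Qed.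

(* Lower semicontinuity of the length at the right end point of the interval. *)
Lemma length_on_left_small a b f (e : R) : a <= b -> 0 < e ->
    (length_on f a b < +oo)%E ->
    (forall d, 0 < d -> exists2 h, 0 < h &
      forall r, a <= r <= b -> b - h < r -> mdist (f r) (f b) < d) ->
  exists2 h, 0 < h & forall r, a <= r <= b -> b - h < r ->
    (length_on f r b <= e%:E)%E.
Proof.
move=> ab e0 fin cont.
have fn : length_on f a b \is a fin_num.
  by rewrite ge0_fin_numE// length_on_ge0.
have e20 : 0 < e / 2 by rewrite divr_gt0.
have [h h0 hP] := cont _ e20.
have [_ [s abs <-]] := ub_ereal_sup_adherent e20 fn.
rewrite -/(length_on f a b) => ltV.
case/lastP: s abs ltV => [/itv_partition_nil -> ltV|s x abs ltV].
  exists 1 => // r /andP[br rb] _; have -> : r = b by apply/eqP; rewrite eq_le rb br.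
  by rewrite length_onxx lee_fin ltW.
have [pth lst] := abs; rewrite last_rcons in lst; move/eqP in lst; subst x.
rewrite rcons_path in pth; move/andP: pth => [pth pb].
(* For r beyond the last inner point, the partition cut off at r shows that [a, r] carries all of
   the near-optimal sum except at most d(f r, f b). So at most e/2 + e/2 of the length is left for
   [r, b]. *)
exists (Num.min h (b - last a s)); first by rewrite lt_min h0/= subr_gt0.
move=> r /andP[ar rb] hr.
have hr1 : b - h < r by apply: le_lt_trans hr; rewrite lerD2l lerN2 ge_min lexx.
have hr2 : last a s < r.
  apply: le_lt_trans hr; rewrite lerBrDr -lerBrDl ge_min lexx orbT//.
have pr : itv_partition a r (rcons s r).
  by split; rewrite ?last_rcons// rcons_path pth.
have ps : itv_partition a (last a s) s by split.
have := length_on_ub f pr.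
rewrite -cats1 (mvariation_cat _ _ _ ps) mvariation_cons mvariation_nil addr0.
move=> lr; move: ltV; rewrite -cats1 (mvariation_cat _ _ _ ps).
rewrite mvariation_cons mvariation_nil addr0 => ltV.
have lar : length_on f a r \is a fin_num.
  by rewrite ge0_fin_numE ?length_on_ge0// (le_lt_trans _ fin)// le_length_on.
have lrb : length_on f r b \is a fin_num.
  rewrite ge0_fin_numE ?length_on_ge0// (le_lt_trans _ fin)//.
  by rewrite (length_onD f ar rb) leeDr// length_on_ge0.
move: ltV lr; rewrite (length_onD f ar rb).
rewrite -(fineK lar) -(fineK lrb) -!EFinD !lte_fin !lee_fin.
have := hP _ (introT andP (conj ar rb)) hr1.
have := metric_triangle (f (last a s)) (f r) (f b).
lra.
Qed.

(** The mirror image of [length_on_left_small]: here the first step of a near-optimal partition is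
    cut at r. *)
Lemma length_on_right_small a b f (e : R) : a <= b -> 0 < e ->
    (length_on f a b < +oo)%E ->
    (forall d, 0 < d -> exists2 h, 0 < h &
      forall r, a <= r <= b -> r < a + h -> mdist (f a) (f r) < d) ->
  exists2 h, 0 < h & forall r, a <= r <= b -> r < a + h ->
    (length_on f a r <= e%:E)%E.
Proof.
move=> ab e0 fin cont.
have fn : length_on f a b \is a fin_num.
  by rewrite ge0_fin_numE// length_on_ge0.
have e20 : 0 < e / 2 by rewrite divr_gt0.
have [h h0 hP] := cont _ e20.
have [_ [s abs <-]] := ub_ereal_sup_adherent e20 fn.
rewrite -/(length_on f a b) => ltV.
case: s abs ltV => [/itv_partition_nil <- ltV|x s abs ltV].
  exists 1 => // r /andP[ar ra] _; have -> : r = a by apply/eqP; rewrite eq_le ar ra.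
  by rewrite length_onxx lee_fin ltW.
have [/= /andP[ax pth] lst] := abs.
exists (Num.min h (x - a)); first by rewrite lt_min h0/= subr_gt0.
move=> r /andP[ar rb] hr.
have hr1 : r < a + h by apply: lt_le_trans hr _; rewrite lerD2l ge_min lexx.
have hr2 : r < x.
  by apply: lt_le_trans hr _; rewrite -lerBrDl ge_min lexx orbT.
have pr : itv_partition r b (x :: s) by split => //=; rewrite hr2.
have := length_on_ub f pr; rewrite mvariation_cons => lr.
move: ltV; rewrite mvariation_cons => ltV.
have lar : length_on f a r \is a fin_num.
  by rewrite ge0_fin_numE ?length_on_ge0// (le_lt_trans _ fin)// le_length_on.
have lrb : length_on f r b \is a fin_num.
  rewrite ge0_fin_numE ?length_on_ge0// (le_lt_trans _ fin)//.
  by rewrite (length_onD f ar rb) leeDr// length_on_ge0.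
move: ltV lr; rewrite (length_onD f ar rb).
rewrite -(fineK lar) -(fineK lrb) -!EFinD !lte_fin !lee_fin.
have := hP _ (introT andP (conj ar rb)) hr1.
have := metric_triangle (f a) (f r) (f x).
lra.
Qed.

End metric_length.

(** For a <= b this is the retraction of the line onto [a, b]; it turns functions on an interval
    into functions on R without losing continuity. *)
Definition clamp {R : realType} (a b t : R) : R := Num.max a (Num.min t b).

Section clamp.
Context {R : realType}.
Implicit Types a b t r : R.

Lemma clamp_itv a b t : a <= b -> a <= clamp a b t <= b.
Proof. by move=> ab; rewrite /clamp le_max lexx/= ge_max ab ge_min lexx orbT. Qed.

Lemma clamp_id a b t : a <= t <= b -> clamp a b t = t.
Proof. by move=> /andP[a_t tb]; rewrite /clamp min_l// max_r. Qed.

Lemma le_clamp a b t r : t <= r -> clamp a b t <= clamp a b r.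
Proof.
move=> tr; rewrite /clamp ge_max le_max lexx/= le_max.
by rewrite le_min !ge_min tr lexx !orbT.
Qed.

Lemma clamp_dist a b t r : a <= b -> t <= r ->
  clamp a b r - clamp a b t <= r - t.
Proof.
move=> ab tr; rewrite /clamp.
case: (leP t b) => tb; case: (leP r b) => rb;
  case: (leP a t) => at'; case: (leP a r) => ar;
  rewrite ?(max_r at') ?(max_r ar) ?(max_l (ltW at')) ?(max_l (ltW ar)) ?(max_r ab); lra.
Qed.
End clamp.

Lemma clamp_norm {R : realType} (a b t r : R) : a <= b ->
  `|clamp a b r - clamp a b t| <= `|r - t|.
Proof.
move=> ab; wlog tr : t r / t <= r.
  move=> H; case: (leP t r) => [/H//|/ltW /H].
  by rewrite distrC [leRHS]distrC.
by rewrite !ger0_norm ?subr_ge0 ?le_clamp// clamp_dist.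
Qed.

Lemma within_continuous_mdist {R : realType} {X : metricType R} (a b : R)
    (f : R -> X) (t d : R) :
    {within `[a, b], continuous f} -> a <= t <= b -> 0 < d ->
  exists2 h, 0 < h & forall r, a <= r <= b -> `|r - t| < h ->
    mdist (f t) (f r) < d.
Proof.
move=> /subspace_continuousP cf atb d0.
have /cf/metricType_numDomainType.cvgrPdist_lt/(_ _ d0) : `[a, b]%classic t.
  by rewrite /= in_itv/=.
rewrite near_withinE => -[h /= h0 hP]; exists h => // r arb rt.
by apply: hP; rewrite /= ?in_itv//= distrC.
Qed.

Section arc_length.
Context {R : realType} {X : metricType R}.
Variable c : curve X.
Hypothesis rc : rectifiable c.

Let lo := c_lo c.
Let hi := c_hi c.
Let lohi : lo <= hi := c_le c.

Lemma curve_length_ge0 : (0 <= curve_length c)%E.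
Proof. exact: length_on_ge0. Qed.

Lemma curve_length_fin : curve_length c \is a fin_num.
Proof. by rewrite ge0_fin_numE// curve_length_ge0. Qed.

Lemma length_on_fin s t : lo <= s -> s <= t -> t <= hi ->
  length_on c s t \is a fin_num.
Proof.
move=> ls st th; rewrite ge0_fin_numE ?length_on_ge0//.
apply: le_lt_trans rc; rewrite /curve_length.
rewrite (length_onD _ ls (le_trans st th)) (length_onD _ st th).
apply: (@le_trans _ _ (length_on c s t + length_on c t hi)%E).
  by rewrite leeDl ?length_on_ge0.
by rewrite leeDr ?length_on_ge0.
Qed.

(** By additivity an increment of the length is the length of a short piece, which is small on
    either side of t by the two preceding estimates. The intermediate value theorem then gives a
    parameter for each length. *)
Lemma length_on_continuous :
  continuous (fun t => fine (length_on c lo (clamp lo hi t))).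
Proof.
have cc := @c_cont _ _ c.
move=> t; apply/cvgrPdist_le => e e0.
pose t' := clamp lo hi t.
have /andP[lt' th'] : lo <= t' <= hi by exact: clamp_itv.
have [h1 h10 P1] : exists2 h, 0 < h & forall r, lo <= r <= t' -> t' - h < r ->
    (length_on c r t' <= e%:E)%E.
  apply: length_on_left_small => //.
    by have := length_on_fin (lexx _) lt' th'; rewrite ge0_fin_numE// length_on_ge0.
  move=> d d0; have [|h h0 hP] := within_continuous_mdist cc (t := t') _ d0.
    by rewrite lt'.
  exists h => // r /andP[lr rt] hr; rewrite metric_sym; apply: hP.
    by rewrite lr (le_trans rt).
  by rewrite ler0_norm ?subr_le0//; lra.
have [h2 h20 P2] : exists2 h, 0 < h & forall r, t' <= r <= hi -> r < t' + h ->
    (length_on c t' r <= e%:E)%E.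
  apply: length_on_right_small => //.
    by have := length_on_fin lt' th' (lexx _); rewrite ge0_fin_numE// length_on_ge0.
  move=> d d0; have [|h h0 hP] := within_continuous_mdist cc (t := t') _ d0.
    by rewrite lt'.
  exists h => // r /andP[tr rh] hr; apply: hP.
    by rewrite rh (le_trans lt').
  by rewrite ger0_norm ?subr_ge0//; lra.
have h0 : 0 < Num.min h1 h2 by rewrite lt_min h10.
near=> r.
have : `|t - r| < Num.min h1 h2.
  near: r; exact: (@cvgr_dist_lt _ _ _ _ _ (fun r : R => r) t).
rewrite lt_min => /andP[d1 d2].
have trc := @clamp_norm _ lo hi r t lohi; rewrite -/t' in trc *.
move: (@clamp_itv _ lo hi r lohi) trc.
set r' := clamp lo hi r => /andP[lr' rh'] trc.
case: (leP r' t') => rt.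
  have := P1 r'; rewrite lr' rt => /(_ isT).
  have -> : t' - h1 < r' by move: trc; rewrite ger0_norm ?subr_ge0//; lra.
  move=> /(_ isT).
  rewrite (length_onD _ lr' rt) fineD ?length_on_fin//.
  rewrite -(fineK (length_on_fin lr' rt th')) lee_fin => le1.
  by rewrite /= addrAC subrr add0r ger0_norm// fine_ge0// length_on_ge0.
have rt' := ltW rt.
have := P2 r'; rewrite rh' rt' => /(_ isT).
have -> : r' < t' + h2 by move: trc; rewrite ler0_norm ?subr_le0//; lra.
move=> /(_ isT).
rewrite (length_onD _ lt' rt') fineD ?length_on_fin//.
rewrite -(fineK (length_on_fin lt' rt' rh')) lee_fin => le1.
by rewrite /= opprD addrA subrr add0r normrN ger0_norm// fine_ge0// length_on_ge0.
Unshelve. all: by end_near. Qed.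

Lemma length_on_surj t : 0 <= t <= fine (curve_length c) ->
  exists2 s, lo <= s <= hi & length_on c lo s = t%:E.
Proof.
move=> /andP[t0 tL].
have [||s] := @IVT R (fun t => fine (length_on c lo (clamp lo hi t))) lo hi t lohi.
- by apply: continuous_subspaceT; exact: length_on_continuous.
- rewrite !clamp_id ?lexx ?lohi// length_onxx/= min_l ?max_r ?t0//;
  by apply: fine_ge0; exact: curve_length_ge0.
rewrite in_itv/= => /andP[ls sh]; rewrite clamp_id ?ls// => <-.
by exists s; rewrite ?ls// fineK// length_on_fin.
Qed.

(** The piece between s and t has length zero, so its end points coincide. Hence [arc_length_param]
    does not depend on the parameter that [xget] picks. *)
Lemma length_on_eq s t : lo <= s <= hi -> lo <= t <= hi ->
  length_on c lo s = length_on c lo t -> c s = c t.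
Proof.
wlog st : s t / s <= t.
  move=> H; case: (leP s t) => [/H//|/ltW ts] ? ? e.
  by apply/esym; apply: H.
move=> /andP[ls sh] /andP[lt th]; rewrite (length_onD _ ls st).
have := length_on_fin (lexx _) ls sh; have := length_on_fin ls st th.
move=> f1 f2; rewrite -(fineK f1) -(fineK f2) -EFinD => -[] /eqP.
rewrite -subr_eq0 opprD addrA subrr add0r oppr_eq0 => /eqP e.
have := mdist_length_on c st; rewrite -(fineK f1) e lee_fin => d0.
by apply: mdist_positivity; apply/eqP; rewrite eq_le d0 mdist_ge0.
Qed.

Lemma arc_length_paramE s t : lo <= s <= hi -> length_on c lo s = t%:E ->
  arc_length_param c t = c s.
Proof.
move=> ls e; rewrite /arc_length_param.
case: xgetP => [r _ [lr er]|/(_ s)]; last by case.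
by apply: length_on_eq => //; rewrite er e.
Qed.

Lemma arc_length_param0 : arc_length_param c 0 = c lo.
Proof. by apply: arc_length_paramE; rewrite ?lexx ?lohi// length_onxx. Qed.

Lemma arc_length_paramL : arc_length_param c (fine (curve_length c)) = c hi.
Proof.
by apply: arc_length_paramE; rewrite ?lexx ?lohi// fineK// curve_length_fin.
Qed.

Lemma le_of_length_on s t : lo <= s <= hi -> lo <= t <= hi ->
  (length_on c lo s < length_on c lo t)%E -> s <= t.
Proof.
move=> /andP[ls sh] /andP[lt th]; rewrite leNgt => lst; apply/negP => /ltW ts.
by move: lst; rewrite ltNge le_length_on.
Qed.

Lemma arc_length_param_lip s t : 0 <= s -> s <= t ->
    t <= fine (curve_length c) ->
  mdist (arc_length_param c s) (arc_length_param c t) <= t - s.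
Proof.
move=> s0; rewrite le_eqVlt => /predU1P[->|st] tL; first by rewrite mdistxx subrr.
have [|a alh ea] := @length_on_surj s; first by rewrite s0 (le_trans (ltW st)).
have [|b blh eb] := @length_on_surj t; first by rewrite tL (le_trans s0 (ltW st)).
rewrite (arc_length_paramE alh ea) (arc_length_paramE blh eb).
have ab : a <= b by apply: le_of_length_on => //; rewrite ea eb lte_fin.
move: (alh) (blh) => /andP[la ah] /andP[lb bh].
have := mdist_length_on c ab; move: eb; rewrite (length_onD _ la ab) ea.
rewrite -(fineK (length_on_fin la ab bh)) lee_fin => -[] e.
lra.
Qed.

(** Restrict c to parameters a <= b at which the lengths s and t are reached; additivity shifts the
    arc length of the restriction by s. *)
Lemma subcurve s t : 0 <= s -> s <= t -> t <= fine (curve_length c) ->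
  exists c' : curve X, [/\ rectifiable c', curve_length c' = (t - s)%:E,
    c' (c_lo c') = arc_length_param c s, c' (c_hi c') = arc_length_param c t &
    forall r, 0 <= r <= t - s ->
      arc_length_param c' r = arc_length_param c (s + r)].
Proof.
move=> s0 st tL.
have [|a alh ea] := @length_on_surj s; first by rewrite s0 (le_trans st).
have [b [ab blh eb]] : exists b, [/\ a <= b, lo <= b <= hi & length_on c lo b = t%:E].
  move: st; rewrite le_eqVlt => /predU1P[<-|st]; first by exists a.
  have [|b blh eb] := @length_on_surj t; first by rewrite tL (le_trans s0 (ltW st)).
  by exists b; split => //; apply: le_of_length_on => //; rewrite ea eb lte_fin.
move: (alh) (blh) => /andP[la ah] /andP[lb bh].
have cc : {within `[a, b], continuous c}.
  apply: continuous_subspaceW (@c_cont _ _ c).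
  by apply: subset_itv; rewrite bnd_simp.
have len : length_on c a b = (t - s)%:E.
  move: eb; rewrite (length_onD _ la ab) ea.
  rewrite -(fineK (length_on_fin la ab bh)) => -[] e.
  by congr EFin; lra.
exists (Curve ab cc); split => //=.
- by rewrite /rectifiable /curve_length /= len ltry.
- by rewrite (arc_length_paramE alh ea).
- by rewrite (arc_length_paramE blh eb).
move=> r /andP[r0 rts].
have [|z zlh ez] := @length_on_surj (s + r).
  by rewrite addr_ge0//=; apply: le_trans tL; lra.
rewrite (arc_length_paramE zlh ez).
(* The parameter z may fall outside [a, b] where the length is constant; an end point of [a, b] then
   has the same length and the same image. *)
have [z' [z'ab z'z ez']] : exists z', [/\ a <= z' <= b, c z' = c z &
   length_on c lo z' = (s + r)%:E].
  case: (leP z a) => za.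
    exists a; split; rewrite ?lexx ?ab//.
      apply: length_on_eq => //; rewrite ea ez.
      have := le_length_on c (proj1 (andP zlh)) za; rewrite ea ez lee_fin => ?.
      by congr EFin; lra.
    have := le_length_on c (proj1 (andP zlh)) za; rewrite ea ez lee_fin => ?.
    by congr EFin; lra.
  case: (leP z b) => zb; first by exists z; rewrite (ltW za).
  have := le_length_on c lb (ltW zb); rewrite eb ez lee_fin => ?.
  have e : (s + r)%:E = t%:E by congr EFin; lra.
  exists b; split; rewrite ?lexx ?ab ?e//.
  by apply: length_on_eq => //; rewrite eb ez.
rewrite -z'z; rewrite /arc_length_param /=.
have lz' : length_on c a z' = r%:E.
  case/andP: z'ab => az' z'b.
  move: ez'; rewrite (length_onD _ la az') ea.
  rewrite -(fineK (length_on_fin la az' (le_trans z'b bh))) => -[] e.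
  by congr EFin; lra.
case: xgetP => [y _ [/andP[ay yb] ey]|/(_ z')]; last by case.
case/andP: z'ab => az' z'b.
apply: length_on_eq; rewrite ?(le_trans la)// ?(le_trans _ bh)//.
by rewrite (length_onD _ la ay) (length_onD _ la az') ey lz'.
Qed.

(** Extended by constants to the whole line, the arc-length parametrization is continuous on R, so
    that Borel functions on X compose with it to measurable functions. *)
Definition arc_clamp (t : R) : X :=
  arc_length_param c (clamp 0 (fine (curve_length c)) t).

Lemma arc_clampE t : 0 <= t <= fine (curve_length c) ->
  arc_clamp t = arc_length_param c t.
Proof. by move=> tL; rewrite /arc_clamp clamp_id. Qed.

Lemma arc_clamp_continuous : continuous arc_clamp.
Proof.
have L0 : 0 <= fine (curve_length c) by rewrite fine_ge0// curve_length_ge0.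
move=> t; apply/metricType_numDomainType.cvgrPdist_lt => e e0; near=> r.
have : `|t - r| < e.
  near: r; exact: (@cvgr_dist_lt _ _ _ _ _ (fun r : R => r) t).
apply: le_lt_trans; rewrite /arc_clamp.
move: (clamp_norm r t L0) (clamp_itv t L0) (clamp_itv r L0).
move: (clamp _ _ t) (clamp _ _ r) => x y xy /andP[x0 xL] /andP[y0 yL].
apply: le_trans xy; case: (leP x y) => [xy|/ltW yx].
  by rewrite distrC ger0_norm ?subr_ge0// arc_length_param_lip.
by rewrite metric_sym ger0_norm ?subr_ge0// arc_length_param_lip.
Unshelve. all: by end_near. Qed.

End arc_length.

(** * Regularity of finite Borel measures and gluing along a curve *)

Local Notation mu1 := lebesgue_measure.

Section finite_measure.
Context d (M : measurableType d) (R : realType).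
Implicit Type m : {measure set M -> \bar R}.

(** Continuity from above of a finite measure, in the form of one index that is good up to e. *)
Lemma nonincreasing_measure_le m (G : (set M)^nat) (e : R) :
    (m setT < +oo)%E -> 0 < e -> (forall n, measurable (G n)) ->
    nonincreasing_seq G ->
  exists n, (m (G n) <= m (\bigcap_n G n) + e%:E)%E.
Proof.
move=> mT e0 mG ndG.
have mI : measurable (\bigcap_n G n) by apply: bigcapT_measurable.
have fin A : measurable A -> m A \is a fin_num.
  move=> mA; rewrite ge0_fin_numE//; apply: le_lt_trans mT.
  by apply: le_measure; rewrite ?inE.
have G0 : (m (G 0%N) < +oo)%E by rewrite -ge0_fin_numE// fin.
have /fine_cvgP[_ /cvgrPdist_le /(_ _ e0)[N _ /(_ N (leqnn _))]] :
    (m \o G) n @[n --> \oo] --> (fine (m (\bigcap_n G n)))%:E.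
  by rewrite fineK ?fin//; exact: nonincreasing_cvg_mu.
rewrite /= => H; exists N.
rewrite -(fineK (fin _ (mG N))) -(fineK (fin _ mI)) -EFinD lee_fin.
by move: H; rewrite distrC ler_distlC; lra.
Qed.

(** Packages the indefinite integral of k as a measure, so that regularity can be applied to it. *)
Lemma density_measure (mu : {measure set M -> \bar R}) (k : M -> \bar R) :
    measurable_fun setT k -> (forall x, 0 <= k x)%E ->
  exists m : {measure set M -> \bar R},
    forall A, m A = (\int[mu]_(x in A) k x)%E.
Proof.
move=> mk k0; pose m A := (\int[mu]_(x in A) k x)%E.
have m0 : m set0 = 0%E by exact: integral_set0.
have mge0 A : (0 <= m A)%E by exact: integral_ge0.
have madd : semi_sigma_additive m.
  move=> F mF tF mUF; rewrite /m ge0_integral_bigcup//; last first.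
    exact: measurable_funTS.
  apply: is_cvg_ereal_nneg_natsum_cond => n _ _; exact: integral_ge0.
pose mM := isMeasure.Build _ _ _ m m0 mge0 madd.
by exists (HB.pack_for {measure set M -> \bar R} m mM).
Qed.

End finite_measure.

Section regularity.
Context {R : realType} {T : metricType R}.
Context d (M : measurableType d) (m : {measure set M -> \bar R}) (p : M -> T).
Hypothesis mp : forall B : set T, borel_set B -> measurable (p @^-1` B).
Hypothesis mT : (m setT < +oo)%E.

Lemma open_borel (U : set T) : open U -> borel_set U.
Proof. exact: sub_sigma_algebra. Qed.

Lemma borel_setC (A : set T) : borel_set A -> borel_set (~` A).
Proof. by move=> bA; rewrite -setTD; exact: sigma_algebraCD. Qed.

Lemma closed_borel (F : set T) : closed F -> borel_set F.
Proof.
by move=> cF; rewrite -(setCK F); exact: borel_setC (open_borel (closed_openC cF)).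
Qed.

Lemma borel_setD (A B : set T) : borel_set A -> borel_set B -> borel_set (A `\` B).
Proof.
move=> bA bB; rewrite setDE -(setCK (A `&` _)) setCI setCK; apply: borel_setC.
rewrite -bigcup2E; apply: sigma_algebra_bigcup => -[|[|n]]//=; first exact: borel_setC.
exact: sigma_algebra0.
Qed.

(** Asking for inner and outer approximation at once makes the class stable under complements. The
    map p carries m to T; it will be a curve or the identity. *)
Let approx (A : set T) := forall e : R, 0 < e -> exists F O,
  [/\ closed F, open O, F `<=` A, A `<=` O & (m (p @^-1` (O `\` F)) <= e%:E)%E].

Lemma open_invS_ball (U : set T) (x : T) : open U -> U x ->
  exists n, forall y, mdist x y < n.+1%:R^-1 -> U y.
Proof.
move=> oU Ux; have /nbhs_ballP[e /= e0 xe] := open_nbhs_nbhs (conj oU Ux).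
have [n _ /(_ n (leqnn _)) nP] := near_infty_natSinv_lt (PosNum e0).
exists n => y xy; apply: xe; rewrite ballEmdist/=.
exact: lt_trans nP.
Qed.

Let approx_open (U : set T) : open U -> approx U.
Proof.
move=> oU e e0.
(* The points at distance at least 1/(n+1) from the complement of U: closed sets that increase to
   U. *)
pose F n := [set x : T | forall y, mdist x y < n.+1%:R^-1 -> U y].
have cF n : closed (F n).
  rewrite -openC openE => x /= /existsNP[y /not_implyP[xy nUy]].
  rewrite /interior; have d0 : 0 < n.+1%:R^-1 - mdist x y by rewrite subr_gt0.
  apply: filterS (nbhsx_ballx x _ d0) => z; rewrite ballEmdist/= => xz /(_ y).
  apply: contra_not nUy; apply; apply: le_lt_trans (metric_triangle z x y) _.
  by rewrite (metric_sym z x) -ltrBrDr.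
have FU n : F n `<=` U by move=> x /(_ x); apply; rewrite mdistxx.
have ndF : nondecreasing_seq F.
  move=> i j ij; rewrite subsetEset => x Fx y xy; apply: Fx.
  by apply: lt_le_trans xy _; rewrite lef_pV2 ?posrE// ler_nat.
have [||n nP] := @nonincreasing_measure_le _ _ _ m (fun n => p @^-1` (U `\` F n)) _ mT e0.
- by move=> n; apply: mp; apply: borel_setD; [exact: open_borel|exact: closed_borel].
- move=> i j ij; rewrite subsetEset => x [Ux nF]; split => //.
  by apply: contra_not nF; move: (ndF _ _ ij); rewrite subsetEset; apply.
exists (F n), U; split => //; apply: le_trans nP _.
rewrite (_ : \bigcap_n _ = set0) ?measure0 ?add0e//.
rewrite -subset0 => x H; have [Ux _] := H 0%N Logic.I.
by have [k kP] := open_invS_ball oU Ux; have [_] := H k Logic.I; apply.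
Qed.

Let approxC (A : set T) : approx A -> approx (~` A).
Proof.
move=> aA e e0; have [F [ O [cF oO FA AO FO]]] := aA e e0.
exists (~` O), (~` F); split; rewrite ?closedC ?openC//; try exact: subsetC.
by rewrite setDE setCK setIC -setDE.
Qed.

(** Approximate the n-th set up to e/2^(n+2) and unite the open sets. The closed sets are united
    only up to a finite index, to stay closed; by continuity from above this costs another e/2. *)
Let approxU (A : (set T)^nat) : (forall n, borel_set (A n)) ->
  (forall n, approx (A n)) -> approx (\bigcup_n A n).
Proof.
move=> bA aA e e0.
have e20 : 0 < e / 2 by rewrite divr_gt0.
have {}aA n : {FO : set T * set T | [/\ closed FO.1, open FO.2, FO.1 `<=` A n,
    A n `<=` FO.2 & (m (p @^-1` (FO.2 `\` FO.1)) <= ((e / 2) / (2 ^ n.+1)%:R)%:E)%E]}.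
  apply: cid; have en0 : 0 < (e / 2) / (2 ^ n.+1)%:R by rewrite divr_gt0// ltr0n expn_gt0.
  by have [F [ O ?]] := aA n _ en0; exists (F, O).
pose F n := (sval (aA n)).1; pose O n := (sval (aA n)).2.
have cF n : closed (F n) by have [] := svalP (aA n).
have oO n : open (O n) by have [] := svalP (aA n).
have FA n : F n `<=` A n by have [] := svalP (aA n).
have AO n : A n `<=` O n by have [] := svalP (aA n).
have FO n : (m (p @^-1` (O n `\` F n)) <= ((e / 2) / (2 ^ n.+1)%:R)%:E)%E.
  by have [] := svalP (aA n).
pose G n := \big[setU/set0]_(i < n) F i.
have cG n : closed (G n) by apply: closed_bigsetU => i _; exact: cF.
pose OO := \bigcup_n O n.
have oOO : open OO by apply: bigcup_open => i _; exact: oO.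
have [||n nP] := @nonincreasing_measure_le _ _ _ m (fun n => p @^-1` (OO `\` G n)) _ mT e20.
- by move=> n; apply: mp; apply: borel_setD; [exact: open_borel|exact: closed_borel].
- move=> i j ij; rewrite subsetEset => x [Ux nF]; split => //.
  by apply: contra_not nF => /=; rewrite /G; apply: subset_bigsetU.
exists (G n), OO; split => //.
- rewrite /G -bigcup_mkord => x [i _ /FA Ax]; by exists i.
- by move=> x [i _ /AO Ox]; exists i.
apply: le_trans nP _; rewrite [in leRHS](splitr e) EFinD leeD2r//.
apply: le_trans (epsilon_trick0 xpredT (ltW e20)).
apply: (@le_trans _ _ (\sum_(i <oo) m (p @^-1` (O i `\` F i)))%E); last first.
  by apply: lee_nneseries.
apply: measure_sigma_subadditive.
- by move=> n'; apply: mp; apply: borel_setD; [exact: open_borel|exact: closed_borel].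
- apply: bigcapT_measurable => i; apply: mp.
  by apply: borel_setD; [exact: open_borel|exact: closed_borel].
move=> x H; have [[i _ Oi] _] := H 0%N Logic.I; exists i => //; split => // Fi.
have [_] := H i.+1 Logic.I; apply => /=; rewrite /G -bigcup_mkord.
by exists i => //=.
Qed.

Lemma borel_regular (A : set T) : borel_set A -> forall e : R, 0 < e ->
  exists F O, [/\ closed F, open O, F `<=` A, A `<=` O &
    (m (p @^-1` (O `\` F)) <= e%:E)%E].
Proof.
(* The induction carries Borel measurability along, because the step for countable unions needs it
   of every set. *)
move=> bA; suff [] : borel_set A /\ approx A by [].
move: A bA; apply: smallest_sub; last first.
  by move=> U oU; split; [exact: open_borel|exact: approx_open].
split.
- by split; [exact: sigma_algebra0|apply: approx_open; exact: open0].
- by move=> A [bA aA]; rewrite setTD; split; [exact: borel_setC|exact: approxC].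
move=> A AP; split; first by apply: sigma_algebra_bigcup => n; have [] := AP n.
by apply: approxU => n; have [] := AP n.
Qed.

End regularity.

(** * A continuity argument comparing increments *)

Section local_growth.
Context {R : realType}.

(** Let c be the supremum of the points at which the bound from a holds. The local comparison at c,
    applied to a point just before it, gives the bound at c; applied to a point just after, it
    contradicts the choice of c unless c = b. *)
Lemma local_growth (a b : R) (f F : R -> R) : a <= b ->
    (forall s t, a <= s -> s <= t -> t <= b -> F s <= F t) ->
    (forall t, a <= t <= b -> exists2 h, 0 < h & forall r, a <= r <= b ->
      `|r - t| < h -> `|f r - f t| <= `|F r - F t|) ->
  `|f b - f a| <= F b - F a.
Proof.
move=> ab ndF loc.
pose S := [set t | a <= t <= b /\ `|f t - f a| <= F t - F a].
have Sa : S a by split; rewrite ?lexx// !subrr normr0.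
have ubS : ubound S b by move=> t [/andP[]].
have hS : has_sup S by split; [exists a|exists b].
pose c := sup S.
have ac : a <= c by apply: ub_le_sup => //; exists b.
have cb : c <= b by apply: ge_sup => //; exists a.
have [h h0 hP] := loc c (introT andP (conj ac cb)).
have [t St ct] := sup_adherent h0 hS; rewrite -/c in ct.
have tc : t <= c by apply: ub_le_sup => //; exists b.
have [/andP[at' tb] ft] := St.
have Sc : `|f c - f a| <= F c - F a.
  have := hP t; rewrite at' tb => /(_ isT).
  have -> : `|t - c| < h by rewrite ler0_norm; lra.
  move=> /(_ isT); rewrite (ler0_norm (x := F t - F c)); last first.
    by rewrite subr_le0 ndF.
  rewrite distrC => ftc; have := ler_normD (f c - f t) (f t - f a).
  by rewrite addrA subrK; lra.
move: cb; rewrite le_eqVlt => /predU1P[<-//|cb].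
pose r := Num.min b (c + h / 2).
have cr : c < r by rewrite lt_min cb; lra.
have rb : r <= b by rewrite ge_min lexx.
have rh : r <= c + h / 2 by rewrite ge_min lexx orbT.
suff Sr : S r by have := ub_le_sup (ex_intro _ b ubS) Sr; rewrite leNgt cr.
have arb : a <= r <= b by rewrite rb (le_trans ac (ltW cr)).
split => //.
have := hP r arb; have -> : `|r - c| < h by rewrite ger0_norm; lra.
move=> /(_ isT); rewrite (ger0_norm (x := F r - F c)); last first.
  by rewrite subr_ge0 ndF// ltW.
move=> frc; have := ler_normD (f r - f c) (f c - f a).
by rewrite addrA subrK; lra.
Qed.

End local_growth.

(** * Borel functions and their composition with curves *)

Notation borel_type X := (g_sigma_algebraType (@open X)).

Section borel_functions.
Context {R : realType} {X : pmetricType R}.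
Implicit Types (g : X -> \bar R).

Lemma borel_funP g :
  borel_fun g <-> measurable_fun [set: borel_type X] (g : borel_type X -> \bar R).
Proof.
split=> [bg _ B mB|mg B mB]; first by rewrite setTI; exact: bg.
by have := mg measurableT B mB; rewrite setTI.
Qed.

Lemma borel_fun_comp d (M : measurableType d) (p : M -> X) g :
    (forall B : set X, borel_set B -> measurable (p @^-1` B)) -> borel_fun g ->
  measurable_fun setT (g \o p).
Proof. by move=> mp bg _ B mB; rewrite setTI; exact: mp (bg _ mB). Qed.

Lemma continuous_borel_preimage (S T : topologicalType) (f : S -> T) (B : set T) :
  continuous f -> borel_set B -> borel_set (f @^-1` B).
Proof.
move=> /continuousP cf; move: B; apply: smallest_sub; last first.
  by move=> U oU; apply: sub_sigma_algebra; exact: cf.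
split => [|A bA|A bA].
- by rewrite /= preimage_set0; exact: sigma_algebra0.
- by rewrite /= setTD preimage_setC -setTD; exact: sigma_algebraCD.
- by rewrite /= preimage_bigcup; exact: sigma_algebra_bigcup.
Qed.

Lemma borel_set_measurable (B : set R) :
  borel_set B -> measurable (B : set (measurableTypeR R)).
Proof.
move: B; apply: smallest_sub; last by move=> U; exact: open_measurable.
split => [|A mA|A mA]; [exact: measurable0|exact: measurableD|].
exact: bigcup_measurable.
Qed.

Lemma continuous_measurable_preimage (p : R -> X) (B : set X) :
  continuous p -> borel_set B -> measurable (p @^-1` B : set (measurableTypeR R)).
Proof.
by move=> cp bB; apply: borel_set_measurable; exact: continuous_borel_preimage.
Qed.

Lemma continuous_borel_measurable (p : R -> X) g :
  continuous p -> borel_fun g ->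
  measurable_fun [set: measurableTypeR R] (g \o p).
Proof.
move=> cp; apply: borel_fun_comp => B.
exact: continuous_measurable_preimage.
Qed.

Lemma borel_fun_patch (E : set X) g h : borel_set E -> borel_fun g -> borel_fun h ->
  borel_fun (fun x => if x \in E then g x else h x).
Proof.
move=> bE /borel_funP bg /borel_funP bh; apply/borel_funP.
apply: measurable_fun_ifT => //.
apply: (measurable_fun_bool true); rewrite setTI.
rewrite (_ : _ @^-1` _ = E)//; apply/seteqP; split => x /=; first by move/set_mem.
by move=> Ex; rewrite mem_set.
Qed.

End borel_functions.

(** Lebesgue measure equals its image under a translation, by uniqueness of the measure with the
    given values on the intervals ]a, b]. *)
Lemma ge0_integral_translation {R : realType} (F : R -> \bar R) (s t : R) :
    measurable_fun [set: measurableTypeR R] F -> (forall x, 0 <= F x)%E ->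
  (\int[lebesgue_measure]_(x in `[0%R, (t - s)%R]) F (s + x)%R =
   \int[lebesgue_measure]_(x in `[s, t]) F x)%E.
Proof.
move=> mF F0.
pose tr : measurableTypeR R -> measurableTypeR R := fun x => s + x.
have mtr : measurable_fun [set: measurableTypeR R] tr.
  by apply: continuous_measurable_fun => x; apply: cvgD; [exact: cvg_cst|exact: cvg_id].
have e A : measurable A -> lebesgue_measure A = pushforward lebesgue_measure tr A.
  move=> mA; apply: lebesgue_measure_unique => //= _ [[a b]] _ <-.
  rewrite /pushforward (_ : tr @^-1` _ = `](a - s)%R, (b - s)%R]%classic).
    by rewrite !lebesgue_measure_itv/= !lte_fin ltrD2r; case: ifP => // _;
      congr EFin; lra.
  by apply/seteqP; split => x /=; rewrite !in_itv/= /tr => /andP[? ?];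
    apply/andP; split; lra.
rewrite -[RHS](@eq_measure_integral _ _ _ _ _ (pushforward lebesgue_measure tr)); last first.
  by move=> A mA _; exact/esym/e.
rewrite ge0_integral_pushforward//; last exact: measurable_funTS.
congr (integral _ _ _); apply/seteqP.
by split => x /=; rewrite !in_itv/= /tr => /andP[? ?]; apply/andP; split; lra.
Qed.

Lemma continuous_open_near {R : realType} {X : topologicalType} (p : R -> X)
    (U : set X) (t : R) : continuous p -> open U -> U (p t) ->
  exists2 h : R, 0 < h & forall r : R, `|r - t| < h -> U (p r).
Proof.
move=> /continuousP cp oU Upt.
have /nbhs_ballP[h /= h0 hP] := open_nbhs_nbhs (conj (cp _ oU) Upt).
by exists h => // r rt; apply: hP; rewrite /ball/= distrC.
Qed.

(** * Gluing two local bounds along a curve *)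

Section gluing.
Context {R : realType} {X : pmetricType R}.
Variables (p : R -> X) (L : R) (H G : X -> \bar R) (E : set X) (f : R -> R).
Hypotheses (cp : continuous p) (L0 : 0 <= L) (bE : borel_set E).
Hypotheses (bH : borel_fun H) (bG : borel_fun G).
Hypotheses (H0 : forall x, (0 <= H x)%E) (G0 : forall x, (0 <= G x)%E).
Hypotheses (Hfin : (\int[mu1]_(t in `[0%R, L]) H (p t) < +oo)%E).
Hypotheses (Gfin : (\int[mu1]_(t in `[0%R, L]) G (p t) < +oo)%E).
Hypothesis locH : forall t : R, 0 <= t <= L -> E (p t) ->
  exists2 h : R, 0 < h & forall r : R, 0 <= r <= L -> `|r - t| < h ->
    (`|f r - f t|%:E <= \int[mu1]_(s in `[Num.min r t, Num.max r t]) H (p s))%E.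
Hypothesis locG : forall t : R, 0 <= t <= L -> ~ E (p t) ->
  exists2 h : R, 0 < h & forall r : R, 0 <= r <= L -> `|r - t| < h ->
    (`|f r - f t|%:E <= \int[mu1]_(s in `[Num.min r t, Num.max r t]) G (p s))%E.

(* Outer regularity of [g (p t) dt], pushed forward to X. *)
Let outer (A : set X) (g : X -> \bar R) (e : R) : borel_set A -> borel_fun g ->
    (forall x, (0 <= g x)%E) -> (\int[mu1]_(t in `[0%R, L]) g (p t) < +oo)%E ->
    0 < e -> exists O, [/\ open O, A `<=` O &
  (\int[mu1]_(t in `[0%R, L]) (g \_ O) (p t) <=
   \int[mu1]_(t in `[0%R, L]) (g \_ A) (p t) + e%:E)%E].
Proof.
move=> bA bg g0 gfin e0.
have mI : measurable (`[0%R, L]%classic : set (measurableTypeR R)) by [].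
have mgp := continuous_borel_measurable cp bg.
have [||m mE] := @density_measure _ _ _ mu1 (((g \o p) \_ `[0%R, L]) : measurableTypeR R -> _).
- exact: (measurable_restrictT (T1 := measurableTypeR R) _ mI).1 (measurable_funTS mgp).
- by move=> x; apply: erestrict_ge0 => y _; exact: g0.
have mE' B : m B = (\int[mu1]_(t in B `&` `[0%R, L]) g (p t))%E.
  by rewrite mE integral_mkcondr.
have [||F [ O [cF oO FA AO FO]]] := borel_regular (m := m) (p := p) _ _ bA e0.
- by move=> B; exact: continuous_measurable_preimage.
- by rewrite mE' setTI.
exists O; split => //.
have mpA : measurable (p @^-1` A : set (measurableTypeR R)).
  exact: continuous_measurable_preimage.
have mpO : measurable (p @^-1` O : set (measurableTypeR R)).
  by apply: continuous_measurable_preimage => //; exact: open_borel.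
have rE B : (\int[mu1]_(t in `[0%R, L]) (g \_ B) (p t) = m (p @^-1` B))%E.
  by rewrite mE' setIC integral_mkcondr.
rewrite !rE -(setDUK (preimage_subset (f := p) AO)).
apply: (@le_trans _ _ (m (p @^-1` A) + m (p @^-1` O `\` p @^-1` A))%E).
  by apply: measureU2 => //; exact: measurableD.
rewrite leeD2l//; apply: le_trans FO; apply: le_measure; rewrite ?inE.
- exact: measurableD.
- apply: continuous_measurable_preimage => //.
  by apply: borel_setD; [exact: open_borel|exact: closed_borel].
by move=> t [Ot nAt]; split => // /FA.
Qed.

(** Enlarge E and its complement to open sets O1 and O2 at a cost of e/2 each for the integrals of H
    and G. Let k be the sum of H cut off to O1 and G cut off to O2. Every parameter has a
    neighbourhood that the curve maps into O1 or into O2, where k dominates the density that works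
    there; so [local_growth] applies with the primitive of k. *)
Lemma gluing : (`|f L - f 0|%:E <=
  \int[mu1]_(t in `[0%R, L]) (if p t \in E then H (p t) else G (p t)))%E.
Proof.
apply/lee_addgt0Pr => e e0; have e20 : 0 < e / 2 by rewrite divr_gt0.
have [ O1 [oO1 EO1 leO1]] := outer bE bH H0 Hfin e20.
have bEC := borel_setC bE.
have [ O2 [oO2 EO2 leO2]] := outer bEC bG G0 Gfin e20.
have mI (a b : R) : measurable (`[a, b]%classic : set (measurableTypeR R)) by [].
have mH (B : set X) : borel_set B ->
    measurable_fun [set: measurableTypeR R] ((H \_ B) \o p).
  move=> bB; apply: continuous_borel_measurable => //; apply: borel_fun_patch => //.
  by apply/borel_funP; exact: measurable_cst.
have mG (B : set X) : borel_set B ->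
    measurable_fun [set: measurableTypeR R] ((G \_ B) \o p).
  move=> bB; apply: continuous_borel_measurable => //; apply: borel_fun_patch => //.
  by apply/borel_funP; exact: measurable_cst.
have H0' B x : (0 <= (H \_ B) x)%E by apply: erestrict_ge0.
have G0' B x : (0 <= (G \_ B) x)%E by apply: erestrict_ge0.
pose k t := ((H \_ O1) (p t) + (G \_ O2) (p t))%E.
have mk : measurable_fun [set: measurableTypeR R] k.
  by apply: emeasurable_funD; [apply: mH|apply: mG]; exact: open_borel.
have k0 t : (0 <= k t)%E by rewrite adde_ge0.
have kint a b : (\int[mu1]_(t in `[a, b]) k t =
    \int[mu1]_(t in `[a, b]) (H \_ O1) (p t) +
    \int[mu1]_(t in `[a, b]) (G \_ O2) (p t))%E.
  rewrite ge0_integralD//; apply: measurable_funTS.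
    by apply: mH; exact: open_borel.
  by apply: mG; exact: open_borel.
pose J (a b : R) := (\int[mu1]_(t in `[a, b]) k t)%E.
have J0 a b : (0 <= J a b)%E by exact: integral_ge0.
have JL : (J 0%R L < +oo)%E.
  have leH : (\int[mu1]_(t in `[0%R, L]) (H \_ O1) (p t) <=
      \int[mu1]_(t in `[0%R, L]) H (p t))%E.
    apply: ge0_le_integral => //.
    - by apply: measurable_funTS; apply: mH; exact: open_borel.
    - by apply: measurable_funTS; exact: continuous_borel_measurable.
    - by move=> t _; rewrite patchE; case: ifPn.
  have leG : (\int[mu1]_(t in `[0%R, L]) (G \_ O2) (p t) <=
      \int[mu1]_(t in `[0%R, L]) G (p t))%E.
    apply: ge0_le_integral => //.
    - by apply: measurable_funTS; apply: mG; exact: open_borel.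
    - by apply: measurable_funTS; exact: continuous_borel_measurable.
    - by move=> t _; rewrite patchE; case: ifPn.
  by rewrite /J kint lte_add_pinfty// ?(le_lt_trans leH)// (le_lt_trans leG).
have Jfin a b : 0 <= a -> b <= L -> J a b \is a fin_num.
  move=> a0 bL; rewrite ge0_fin_numE//; apply: le_lt_trans JL.
  apply: ge0_subset_integral => //; first exact: measurable_funTS.
  by apply: subset_itv; rewrite bnd_simp.
have JD a b c : a <= b -> b <= c -> (J a c = J a b + J b c)%E.
  move=> ab bc; rewrite /J.
  have -> : (\int[mu1]_(t in `[b, c]) k t = \int[mu1]_(t in `]b, c]) k t)%E.
    by rewrite -integral_itv_obnd_cbnd//; exact: measurable_funTS.
  rewrite -ge0_integral_setU//; last 2 first.
  - exact: measurable_funTS.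
  - apply/disj_setPLR => x /=; rewrite !in_itv/= => /andP[_ xb] /andP[bx _].
    by move: bx; rewrite ltNge xb.
  congr (integral _ _ _); apply/seteqP; split => x /=; rewrite !in_itv/=.
    by move=> /andP[ax xc]; case: (leP x b) => xb; [left|right]; apply/andP.
  by move=> [/andP[ax xb]|/andP[bx xc]]; rewrite ?ax ?xc ?(le_trans xb) ?(le_trans ab (ltW bx)).
pose Fk t := fine (J 0 t).
have FkE s t : 0 <= s -> s <= t -> t <= L -> ((Fk t - Fk s)%:E = J s t)%E.
  move=> s0 st tL; rewrite /Fk (JD _ _ _ s0 st) fineD ?Jfin ?(le_trans st)//.
  by rewrite addrAC subrr add0r fineK// Jfin.
have bound (a b : R) (g : X -> \bar R) (U : set X) : borel_fun g -> open U ->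
    (forall x, (0 <= g x)%E) -> (forall s, a <= s <= b -> U (p s)) -> (forall s, (g \_ U) (p s) <= k s)%E ->
    (\int[mu1]_(s in `[a, b]) g (p s) <= J a b)%E.
  move=> bg oU g0 HU gk; apply: ge0_le_integral => //.
  - by apply: measurable_funTS; exact: continuous_borel_measurable.
  - exact: measurable_funTS.
  - move=> s /=; rewrite in_itv/= => /HU Us; apply: le_trans (gk s).
    by rewrite patchE mem_set.
have : `|f L - f 0| <= Fk L - Fk 0.
  apply: local_growth => //.
    move=> s t s0 st tL; rewrite -subr_ge0 -lee_fin FkE//.
  move=> t tL.
  have /andP[t0 tL'] := tL.
  have [g [ U [bg oU g0 [Ut gk [h h0 hP]]]]] :
     exists g (U : set X), [/\ borel_fun g, open U,
     (forall x, (0 <= g x)%E) & [/\ U (p t), (forall s, (g \_ U) (p s) <= k s)%E &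
     exists2 h : R, 0 < h & forall r : R, 0 <= r <= L -> `|r - t| < h ->
    (`|f r - f t|%:E <= \int[mu1]_(s in `[Num.min r t, Num.max r t]) g (p s))%E]].
    case: (pselect (E (p t))) => [Et|nEt].
      exists H, O1; split => //; split; [exact: EO1| |exact: locH].
      by move=> s; rewrite /k leeDl.
    exists G, O2; split => //; split; [exact: EO2| |exact: locG].
    by move=> s; rewrite /k leeDr.
  have [h' h'0 h'P] := continuous_open_near cp oU Ut.
  exists (Num.min h h'); first by rewrite lt_min h0.
  move=> r rL; rewrite lt_min => /andP[rh rh'].
  have /andP[r0 rL'] := rL.
  rewrite -lee_fin; apply: le_trans (hP r rL rh) _.
  case: (leP r t) => rt.
    rewrite distrC ger0_norm; last by rewrite -lee_fin FkE.
    rewrite FkE//; apply: (bound _ _ _ U) => // s /andP[rs st].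
    apply: h'P; apply: le_lt_trans rh'.
    by rewrite !ler0_norm ?subr_le0//; lra.
  have rt' := ltW rt.
  rewrite ger0_norm; last by rewrite -lee_fin FkE.
  rewrite FkE//; apply: (bound _ _ _ U) => // s /andP[rs st].
  apply: h'P; apply: le_lt_trans rh'.
  by rewrite !ger0_norm ?subr_ge0//; lra.
rewrite -lee_fin FkE// => /le_trans; apply.
rewrite /J kint; apply: le_trans (leeD leO1 leO2) _.
rewrite addeACA -EFinD -splitr leeD2r//.
rewrite -ge0_integralD//; last 2 first.
- by apply: measurable_funTS; exact: mH.
- by apply: measurable_funTS; exact: mG.
apply: ge0_le_integral => //.
- by move=> t _; rewrite adde_ge0.
- by apply: emeasurable_funD; apply: measurable_funTS; [exact: mH|exact: mG].
- apply: measurable_funTS.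
  exact: (continuous_borel_measurable cp (borel_fun_patch bE bH bG)).
move=> t _; rewrite !patchE in_setC; case: ifPn => _ /=; rewrite ?adde0 ?add0e//.
Qed.

End gluing.

(** * Exceptional families and minimal weak upper gradients *)

Section path_integrals.
Context {R : realType} {X : pmetricType R}.
Variable c : curve X.
Hypothesis rc : rectifiable c.
Let L := fine (curve_length c).
Let p := arc_clamp c.

Lemma path_integralE (g : X -> \bar R) :
  path_integral g c = (\int[mu1]_(t in `[0%R, L]) g (p t))%E.
Proof.
by apply: eq_integral => t; rewrite inE /= in_itv/= => tL; rewrite /p arc_clampE.
Qed.

Lemma path_integral_subcurve (s t : R) : 0 <= s -> s <= t -> t <= L ->
  exists c' : curve X, [/\ rectifiable c', c' (c_lo c') = p s,
    c' (c_hi c') = p t & forall g, borel_fun g -> (forall x, 0 <= g x)%E ->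
    path_integral g c' = (\int[mu1]_(r in `[s, t]) g (p r))%E].
Proof.
move=> s0 st tL; have [c' [rc' lc' c's c't c'E]] := subcurve rc s0 st tL.
exists c'; split => //.
- by rewrite c's /p arc_clampE// s0 (le_trans st).
- by rewrite c't /p arc_clampE// tL (le_trans s0).
move=> g bg g0; rewrite -(@ge0_integral_translation _ (g \o p) s t); last 2 first.
- by apply: continuous_borel_measurable => //; exact: arc_clamp_continuous.
- by move=> x; exact: g0.
rewrite /path_integral lc'; apply: eq_integral => r.
rewrite inE /= in_itv/= => /andP[r0 rts]; rewrite c'E ?r0// /p arc_clampE//.
by rewrite addr_ge0//=; apply: le_trans tL; lra.
Qed.

Lemma le_path_integral_sub (g h : X -> \bar R) (s t : R) : 0 <= s -> t <= L ->
    borel_fun g -> (forall x, 0 <= g x)%E ->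
    borel_fun h -> (forall x, (g x <= h x)%E) ->
  (\int[mu1]_(r in `[s, t]) g (p r) <= path_integral h c)%E.
Proof.
have cp := arc_clamp_continuous rc => s0 tL bg g0 bh gh; rewrite path_integralE.
apply: (@le_trans _ _ (\int[mu1]_(r in `[s, t]) h (p r))%E).
  apply: ge0_le_integral => //.
  - by apply: measurable_funTS; exact: continuous_borel_measurable.
  - by apply: measurable_funTS; exact: continuous_borel_measurable.
apply: ge0_subset_integral => //.
- by apply: measurable_funTS; exact: continuous_borel_measurable.
- by move=> x _; exact: le_trans (g0 _) (gh _).
- by apply: subset_itv; rewrite bnd_simp.
Qed.

Lemma le_path_integral (g h : X -> \bar R) :
    borel_fun g -> (forall x, 0 <= g x)%E ->
    borel_fun h -> (forall x, (g x <= h x)%E) ->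
  (path_integral g c <= path_integral h c)%E.
Proof. by move=> *; rewrite [leLHS]path_integralE le_path_integral_sub. Qed.

Lemma path_integralZ (g : X -> \bar R) (k : R) :
    borel_fun g -> (forall x, 0 <= g x)%E -> 0 <= k ->
  path_integral (fun x => k%:E * g x)%E c = (k%:E * path_integral g c)%E.
Proof.
move=> bg g0 k0; rewrite !path_integralE ge0_integralZl_EFin//.
apply: measurable_funTS; apply: continuous_borel_measurable => //.
exact: arc_clamp_continuous.
Qed.

(** The upper gradient inequality on all pieces of c at once; this form can be localized in the
    parameter. *)
Definition ug_along (u : X -> R) (g : X -> \bar R) := forall s t : R,
  0 <= s -> s <= t -> t <= L ->
  (`|u (p s) - u (p t)|%:E <= \int[mu1]_(r in `[s, t]) g (p r))%E.

Lemma ug_along_ineq (u : X -> R) (g : X -> \bar R) :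
  ug_along u g -> upper_gradient_ineq u g c.
Proof.
have L0 : 0 <= L by rewrite fine_ge0// curve_length_ge0.
move=> /(_ 0 L (lexx _) L0 (lexx _)); rewrite /upper_gradient_ineq path_integralE.
by rewrite /p !arc_clampE ?lexx ?L0// arc_length_param0// arc_length_paramL.
Qed.

Lemma ug_along_sym (u : X -> R) (g : X -> \bar R) (r t : R) : ug_along u g ->
    0 <= r <= L -> 0 <= t <= L ->
  (`|u (p r) - u (p t)|%:E <=
    \int[mu1]_(s in `[Num.min r t, Num.max r t]) g (p s))%E.
Proof.
move=> ug /andP[r0 rL] /andP[t0 tL]; case: (leP r t) => rt; first exact: ug.
by rewrite distrC; apply: ug => //; exact: ltW.
Qed.

End path_integrals.

Lemma invr2SX_nneseries {R : realType} :
  (\sum_(n <oo) ((2 ^ n.+1)%:R^-1 : R)%:E <= 1)%E.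
Proof.
have := @epsilon_trick0 R 1 xpredT ler01; apply: le_trans.
by apply: lee_nneseries => n _; rewrite ?lee_fin ?invr_ge0// div1r.
Qed.

(** * Nonnegative Borel functions in L^q *)

Section lebesgue_borel.
Context {R : realType} {X : pmetricType R} (mu : {outer_measure set X -> \bar R}).
Hypothesis hb : forall B, borel_set B -> mu.-caratheodory B.
Variable q : R.
Hypothesis q1 : 1 <= q.
Let XM := caratheodory_type mu.
Let muM : {measure set XM -> \bar R} := cara_measure mu.
Local Notation Iq g := (\int[muM]_x (g x `^ q))%E.
Implicit Types (u : X -> R) (g h rho : X -> \bar R).

Let q0 : 0 < q. Proof. exact: lt_le_trans q1. Qed.
Let qn0 : q != 0. Proof. exact: lt0r_neq0. Qed.

Lemma borel_cara g : borel_fun g -> measurable_fun [set: XM] (g : XM -> \bar R).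
Proof. exact: (@borel_fun_comp _ _ _ XM id). Qed.

Lemma borel_cara_pow g : borel_fun g ->
  measurable_fun [set: XM] ((fun x => g x `^ q)%E : XM -> \bar R).
Proof.
by move=> bg; apply: measurableT_comp (measurable_poweR q) (borel_cara bg).
Qed.

(** Finiteness is asked of the integral of the q-th power, which scales and adds without taking
    roots; [Lq_borelP] relates it to [in_Lq]. *)
Definition Lq_borel g := [/\ borel_fun g, forall x, (0 <= g x)%E & (Iq g < +oo)%E].

Lemma le_poweR (x y : \bar R) : (0 <= x)%E -> (x <= y)%E -> (x `^ q <= y `^ q)%E.
Proof.
move=> g0 gh; apply: gt0_ler_poweR => //; first exact: ltW.
- by rewrite in_itv/= g0 leey.
- by rewrite in_itv/= (le_trans g0)// leey.
Qed.

Lemma le_Iq g h : borel_fun g -> (forall x, 0 <= g x)%E -> borel_fun h ->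
  (forall x, g x <= h x)%E -> (Iq g <= Iq h)%E.
Proof.
move=> bg g0 bh gh; apply: ge0_le_integral => //.
- by move=> x _; exact: poweR_ge0.
- exact: borel_cara_pow.
- exact: borel_cara_pow.
- by move=> x _; exact: le_poweR.
Qed.

Lemma Iq_ge0 g : (0 <= Iq g)%E.
Proof. by apply: integral_ge0 => x _; exact: poweR_ge0. Qed.

Lemma le_Lq_borel g h : Lq_borel h -> borel_fun g -> (forall x, 0 <= g x)%E ->
  (forall x, g x <= h x)%E -> Lq_borel g.
Proof.
by move=> [bh h0 hq] bg g0 gh; split => //; apply: le_lt_trans hq; exact: le_Iq.
Qed.

Lemma in_Lq_ge0P (g : X -> \bar R) : (forall x, 0 <= g x)%E ->
  (('N[muM]_(q%:E)[g] < +oo)%E <-> (Iq g < +oo)%E).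
Proof.
move=> g0; have e : (Iq g = 'N[muM]_(q%:E)[g] `^ q)%E.
  by rewrite poweR_Lnorm//; apply: eq_integral => x _; rewrite gee0_abs.
by rewrite e; split => [|/lty_poweRy]; [exact: poweR_lty|exact].
Qed.

Lemma Lq_borelP g : borel_fun g -> (forall x, 0 <= g x)%E ->
  in_Lq mu q g <-> Lq_borel g.
Proof.
move=> bg g0; split => [[mg /(in_Lq_ge0P g0)]//|[_ _ /(in_Lq_ge0P g0)] //].
by split => //; exact: borel_cara.
Qed.

Lemma IqZ g (k : R) : borel_fun g -> (forall x, 0 <= g x)%E -> 0 <= k ->
  Iq (fun x => k%:E * g x)%E = ((k `^ q)%:E * Iq g)%E.
Proof.
move=> bg g0 k0; rewrite -ge0_integralZl_EFin ?powR_ge0//.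
- by apply: eq_integral => x _; rewrite poweRM// poweR_EFin.
- by move=> x _; exact: poweR_ge0.
- exact: borel_cara_pow.
Qed.

Lemma borel_funZ g (k : R) : borel_fun g -> borel_fun (fun x => k%:E * g x)%E.
Proof.
by move=> /borel_funP bg; apply/borel_funP; exact: measurable_funeM.
Qed.

Lemma Lq_borelZ g (k : R) : 0 <= k -> Lq_borel g ->
  Lq_borel (fun x => k%:E * g x)%E.
Proof.
move=> k0 [bg g0 gq]; split; [exact: borel_funZ| |].
  by move=> x; rewrite mule_ge0// lee_fin.
by rewrite IqZ// lte_mul_pinfty// lee_fin powR_ge0.
Qed.

Lemma Lq_borel_maxe g h : Lq_borel g -> Lq_borel h ->
  Lq_borel (fun x => maxe (g x) (h x)).
Proof.
move=> [bg g0 gq] [bh h0 hq].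
have bm : borel_fun (fun x => maxe (g x) (h x)).
  by apply/borel_funP; apply: measurable_maxe; apply/borel_funP.
split => //; first by move=> x; rewrite le_max g0.
apply: (@le_lt_trans _ _ (Iq g + Iq h)%E); last by rewrite lte_add_pinfty.
rewrite -ge0_integralD//; last 4 first.
- by move=> x _; exact: poweR_ge0.
- exact: borel_cara_pow.
- by move=> x _; exact: poweR_ge0.
- exact: borel_cara_pow.
apply: ge0_le_integral => //.
- by move=> x _; exact: poweR_ge0.
- exact: borel_cara_pow.
- by apply: emeasurable_funD; exact: borel_cara_pow.
by move=> x _; case: (leP (g x) (h x)) => _; rewrite ?leeDl ?leeDr ?poweR_ge0.
Qed.

(** Take for rho the pointwise l^q norm of the sequence: it dominates each term, and the integral of
    its q-th power is the sum of the integrals, at most 1. *)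
Lemma Lq_series (a : nat -> X -> \bar R) : (forall n, borel_fun (a n)) ->
    (forall n x, 0 <= a n x)%E -> (forall n, Iq (a n) <= ((2 ^ n.+1)%:R^-1)%:E)%E ->
  exists2 rho, Lq_borel rho & forall n x, (a n x <= rho x)%E.
Proof.
move=> ba a0 aq; pose S x := (\sum_(n <oo) a n x `^ q)%E.
have S0 x : (0 <= S x)%E by apply: nneseries_ge0 => n _ _; exact: poweR_ge0.
have powK (y : \bar R) : (0 <= y)%E -> ((y `^ q^-1) `^ q = y)%E.
  by move=> y0; rewrite -poweRrM mulVf// poweRe1.
exists (fun x => S x `^ q^-1)%E; last first.
  move=> n x; rewrite -[leLHS](poweRe1 (a0 n x)) -(@mulfV _ q)// poweRrM.
  apply: gt0_ler_poweR; rewrite ?invr_ge0 ?(ltW q0)//.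
  - by rewrite in_itv/= leey poweR_ge0.
  - by rewrite in_itv/= leey S0.
  apply: le_trans (nneseries_lim_ge n.+1 _) => [|i _ _]; last exact: poweR_ge0.
  by rewrite big_nat_recr//= leeDr// sume_ge0// => i _; exact: poweR_ge0.
have bS : borel_fun S.
  apply/borel_funP; apply: ge0_emeasurable_sum => [k x _ _|k _]; first exact: poweR_ge0.
  by apply: measurableT_comp (measurable_poweR q) _; apply/borel_funP.
split.
- apply/borel_funP; apply: measurableT_comp (measurable_poweR _) _.
  exact/borel_funP.
- by move=> x; exact: poweR_ge0.
have -> : (\int[muM]_x ((S x `^ q^-1) `^ q) = \int[muM]_x S x)%E.
  by apply: eq_integral => x _; rewrite powK.
rewrite integral_nneseries//; last 2 first.
- by move=> n; exact: borel_cara_pow.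
- by move=> n x _; exact: poweR_ge0.
apply: (@le_lt_trans _ _ 1%E); last exact: ltry.
apply: le_trans invr2SX_nneseries.
by apply: lee_nneseries => n *; [exact: Iq_ge0|exact: aq].
Qed.

(** * Families of curves of modulus zero *)

Lemma small_scale g (e : R) : 0 < e -> Lq_borel g ->
  exists2 k : R, 0 < k & (Iq (fun x => k%:E * g x)%E <= e%:E)%E.
Proof.
move=> e0 [bg g0 gq]; have I0 := Iq_ge0 g.
have Ifin : Iq g \is a fin_num by rewrite ge0_fin_numE.
have i0 : 0 <= fine (Iq g) by rewrite fine_ge0.
(* Chosen so that k^q times the integral is at most e; the summand 1 covers the case of a vanishing
   integral. *)
pose k := (e / (1 + fine (Iq g))) `^ q^-1.
have k0 : 0 < k by apply: powR_gt0; rewrite divr_gt0// ltr_wpDr.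
exists k => //; rewrite IqZ// ?(ltW k0)// -(fineK Ifin) -EFinM lee_fin.
rewrite /k -powRrM mulVf// powRr1; last by rewrite divr_ge0 ?ltW// ltr_wpDr.
rewrite mulrAC ler_pdivrMr ?ltr_wpDr// ler_wpM2l ?(ltW e0)//; lra.
Qed.

(** A positive factor does not change on which curves a line integral is infinite. So the functions
    are scaled to have summable integrals and dominated by one function: countably many exceptional
    families merge into one. *)
Lemma Lq_countable (r : nat -> X -> \bar R) : (forall n, Lq_borel (r n)) ->
  exists2 rho, Lq_borel rho & forall c, rectifiable c ->
    (path_integral rho c < +oo)%E -> forall n, (path_integral (r n) c < +oo)%E.
Proof.
move=> Lr.
have kP n : {k : R | 0 < k /\ (Iq (fun x => k%:E * r n x)%E <= ((2 ^ n.+1)%:R^-1)%:E)%E}.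
  apply: cid; have e0 : 0 < (2 ^ n.+1)%:R^-1 :> R by rewrite invr_gt0 ltr0n expn_gt0.
  by have [k k0 kq] := small_scale e0 (Lr n); exists k.
have br n : borel_fun (r n) by have [] := Lr n.
have r0 n x : (0 <= r n x)%E by have [] := Lr n.
have [|||rho Lrho le_rho] := @Lq_series (fun n x => (sval (kP n))%:E * r n x)%E.
- by move=> n; exact: borel_funZ.
- by move=> n x; have [k0 _] := svalP (kP n); rewrite mule_ge0// lee_fin ltW.
- by move=> n; have [] := svalP (kP n).
exists rho => // c rc fin n; have [k0 _] := svalP (kP n).
have [brho _ _] := Lrho.
rewrite ltNge leye_eq; apply/eqP => e; move: fin; rewrite ltNge => /negP; apply.
apply: le_trans (le_path_integral rc (borel_funZ _ (br n)) _ brho (le_rho n)).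
  by rewrite (path_integralZ rc (br n) (r0 n) (ltW k0)) e gt0_muley// leey.
by move=> x; rewrite mule_ge0// lee_fin ltW.
Qed.

(** Admissible functions with small integrals, multiplied by n + 1, are dominated by one L^q
    function rho, whose line integral over a curve of G is then at least n + 1 for every n. *)
Lemma modulus0_exceptional (G : set (curve X)) : modulus mu q G = 0%E ->
  exists2 rho, Lq_borel rho & forall c, G c -> rectifiable c ->
    path_integral rho c = +oo%E.
Proof.
move=> G0.
(* The factor n + 1 multiplies the integral by its q-th power, which the denominator compensates;
   2^-(n+1) remains. *)
pose e n : R := (2 ^ n.+1)%:R^-1 / (n.+1%:R `^ q).
have e0 n : 0 < e n.
  by rewrite divr_gt0 ?invr_gt0 ?ltr0n ?expn_gt0// powR_gt0.
have aP n : {rho | admissible G rho /\ (Iq rho < (e n)%:E)%E}.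
  apply: cid; have : (modulus mu q G < (e n)%:E)%E by rewrite G0 lte_fin.
  by move=> /ereal_inf_lt[_ [rho arho <-] lt_e]; exists rho.
pose r n := sval (aP n).
have br n : borel_fun (r n) by have [[]] := svalP (aP n).
have r0 n x : (0 <= r n x)%E by have [[_ H _] _] := svalP (aP n); exact: H.
have r1 n c : G c -> rectifiable c -> (1 <= path_integral (r n) c)%E.
  by have [[_ _ H] _] := svalP (aP n); exact: H.
have rq n : (Iq (r n) < (e n)%:E)%E by have [] := svalP (aP n).
have [|||rho Lrho le_rho] := @Lq_series (fun n x => n.+1%:R%:E * r n x)%E.
- by move=> n; exact: borel_funZ.
- by move=> n x; rewrite mule_ge0.
- move=> n; rewrite IqZ//; apply: (@le_trans _ _ ((n.+1%:R `^ q)%:E * (e n)%:E)%E).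
    by rewrite lee_wpmul2l ?lee_fin ?powR_ge0// ltW.
  by rewrite -EFinM lee_fin /e mulrCA divff ?mulr1// gt_eqF// powR_gt0.
exists rho => // c Gc rc; have [brho rho0 _] := Lrho.
apply/eqyP => A A0.
have [n An] : exists n, A <= n.+1%:R.
  exists (Num.truncn A); exact/ltW/truncnS_gt.
apply: le_trans (le_path_integral rc (borel_funZ _ (br n)) _ brho (le_rho n)); last first.
  by move=> x; rewrite mule_ge0.
rewrite path_integralZ//; apply: (@le_trans _ _ (n.+1%:R%:E * 1)%E).
  by rewrite mule1 lee_fin.
by rewrite lee_wpmul2l// r1.
Qed.

(** Every positive multiple of rho is admissible, and its integral can be made arbitrarily small. *)
Lemma exceptional_modulus0 (G : set (curve X)) rho : Lq_borel rho ->
    (forall c, G c -> rectifiable c -> path_integral rho c = +oo%E) ->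
  modulus mu q G = 0%E.
Proof.
move=> Lrho Grho; apply/eqP; rewrite eq_le; apply/andP; split; last first.
  by apply: le_ereal_inf_tmp => _ [r _ <-]; exact: Iq_ge0.
apply/lee_addgt0Pr => e e0; rewrite add0e.
have [k k0 kq] := small_scale e0 Lrho; have [br r0 _] := Lrho.
apply: le_trans kq; apply: ereal_inf_lbound; exists (fun x => k%:E * rho x)%E => //.
split; first exact: borel_funZ.
  by move=> x; rewrite mule_ge0// lee_fin ltW.
move=> c Gc rc; rewrite path_integralZ// ?(ltW k0)// Grho// gt0_muley//.
exact: leey.
Qed.

(** Replaces the modulus by one exceptional function, which even controls all pieces of a curve: if
    the inequality fails on a piece, rho has infinite line integral there, hence also over c. *)
Lemma weak_upper_gradientP u g : borel_fun g -> (forall x, 0 <= g x)%E ->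
  weak_upper_gradient mu q u g <-> exists2 rho, Lq_borel rho &
    forall c, rectifiable c -> (path_integral rho c < +oo)%E -> ug_along c u g.
Proof.
move=> bg g0; split; last first.
  move=> [rho Lrho ug]; split => //; apply: (exceptional_modulus0 Lrho).
  move=> c [rc nug] _; apply: contra_notP nug => /eqP fin.
  by apply: ug_along_ineq => //; apply: ug => //; rewrite ltey.
move=> [_ _ /modulus0_exceptional[rho Lrho rhoE]]; exists rho => // c rc fin s t s0 st tL.
have [c' [rc' <- <- c'E]] := path_integral_subcurve rc s0 st tL.
have [br r0 _] := Lrho.
rewrite -c'E//; apply: contrapT => nug.
have := rhoE c' (conj rc' nug) rc'; rewrite c'E// => e.
have := le_path_integral_sub rc s0 tL br r0 br (fun=> lexx _).
by rewrite e leye_eq => /eqP e'; move: fin; rewrite e' ltxx.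
Qed.

Lemma weak_upper_gradient_glue u g h (E : set X) : weak_upper_gradient mu q u g ->
    Lq_borel g -> Lq_borel h -> borel_set E ->
    (exists2 rho, Lq_borel rho & forall c, rectifiable c ->
      (path_integral rho c < +oo)%E ->
      forall t, 0 <= t <= fine (curve_length c) -> E (arc_clamp c t) ->
      exists2 d : R, 0 < d & forall r, 0 <= r <= fine (curve_length c) ->
        `|r - t| < d -> (`|u (arc_clamp c r) - u (arc_clamp c t)|%:E <=
        \int[mu1]_(s in `[Num.min r t, Num.max r t]) h (arc_clamp c s))%E) ->
  weak_upper_gradient mu q u (fun x => if x \in E then h x else g x).
Proof.
move=> wg Lg Lh bE [rho Lrho loc].
have [bg g0 _] := Lg; have [bh h0 _] := Lh; have [br r0 _] := Lrho.
have [sg Lsg sgP] := (weak_upper_gradientP u bg g0).1 wg.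
have [bs s0 _] := Lsg.
(* One function th controls all four: wherever its line integral is finite, g and h are integrable
   along the curve, and neither exceptional function excludes it. Beyond the list the sequence
   repeats g. *)
pose r4 n := nth g [:: g; h; rho; sg] n.
have [|th Lth thP] := @Lq_countable r4.
  by case=> [|[|[|[|n]]]]; rewrite /r4//= nth_nil.
split; first exact: borel_fun_patch.
  by move=> x; case: ifPn.
apply: (exceptional_modulus0 Lth) => c [rc nug] _.
apply: contra_notP nug => /eqP fin.
have {}fin : (path_integral th c < +oo)%E by rewrite ltey.
have /= fg := thP c rc fin 0%N; have /= fh := thP c rc fin 1%N.
have /= fr := thP c rc fin 2%N; have /= fs := thP c rc fin 3%N.
have L0 : 0 <= fine (curve_length c) by rewrite fine_ge0// curve_length_ge0.
rewrite /upper_gradient_ineq path_integralE//.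
have -> : `|u (c (c_lo c)) - u (c (c_hi c))| =
    `|u (arc_clamp c (fine (curve_length c))) - u (arc_clamp c 0)|.
  by rewrite distrC !arc_clampE ?lexx ?L0// arc_length_param0// arc_length_paramL.
apply: (@gluing _ _ _ _ h g E (u \o arc_clamp c)) => //.
- exact: arc_clamp_continuous.
- by rewrite -path_integralE.
- by rewrite -path_integralE.
- exact: loc.
- move=> t tL _; exists 1 => // r rL _.
  by apply: ug_along_sym => //; exact: sgP.
Qed.

(** The lattice property: glue h into g on the Borel set where h is smaller. *)
Lemma weak_upper_gradient_mine u g h : weak_upper_gradient mu q u g ->
    weak_upper_gradient mu q u h -> Lq_borel g -> Lq_borel h ->
  weak_upper_gradient mu q u (fun x => mine (g x) (h x)).
Proof.
move=> wg wh Lg Lh; have [bg g0 _] := Lg; have [bh h0 _] := Lh.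
pose E := [set x | (h x < g x)%E].
have bE : borel_set E.
  have := @measurable_lte _ (borel_type X) R setT measurableT h g; rewrite setTI; apply => //.
  - exact/borel_funP.
  - exact/borel_funP.
rewrite (_ : (fun x => _) = (fun x => if x \in E then h x else g x)).
  apply: weak_upper_gradient_glue => //.
  have [rho Lrho rhoP] := (weak_upper_gradientP u bh h0).1 wh.
  exists rho => // c rc fin t tL _; exists 1 => // r rL _.
  by apply: ug_along_sym => //; exact: rhoP.
apply/funext => x; case: (leP (g x) (h x)) => gh.
  by rewrite ifF//; apply/negbTE; rewrite notin_setE /E/=; apply/negP; rewrite -leNgt.
by rewrite mem_set.
Qed.

(** Dominated convergence along almost every curve, with [g 0] as the dominating function. *)
Lemma weak_upper_gradient_lim u (g : nat -> X -> \bar R) :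
    (forall n, weak_upper_gradient mu q u (g n)) -> (forall n, Lq_borel (g n)) ->
    (forall x, nonincreasing_seq (g ^~ x)) ->
    let gi := fun x => ereal_inf (range (g ^~ x)) in
  weak_upper_gradient mu q u gi /\ Lq_borel gi.
Proof.
move=> wg Lg ndg gi.
have bg n : borel_fun (g n) by have [] := Lg n.
have g0 n x : (0 <= g n x)%E by have [] := Lg n.
have cvg x : g n x @[n --> \oo] --> gi x by exact: ereal_nonincreasing_cvgn.
have bgi : borel_fun gi.
  apply/borel_funP; apply: (@emeasurable_fun_cvg _ (borel_type X) R setT g) => //.
  by move=> n; exact/borel_funP.
have gi0 x : (0 <= gi x)%E by apply: le_ereal_inf_tmp => _ [n _ <-].
have gile n x : (gi x <= g n x)%E by apply: ereal_inf_lbound; exists n.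
split; last exact: le_Lq_borel (Lg 0%N) bgi gi0 (gile 0%N).
apply/weak_upper_gradientP => //.
have rP n : {rho | Lq_borel rho /\ forall c, rectifiable c ->
    (path_integral rho c < +oo)%E -> ug_along c u (g n)}.
  by apply: cid; have [rho ? ?] := (weak_upper_gradientP u (bg n) (g0 n)).1 (wg n); exists rho.
have [|rho1 Lrho1 rho1P] := @Lq_countable (fun n => sval (rP n)).
  by move=> n; have [] := svalP (rP n).
(* Merging [g 0] into the exceptional function makes it integrable along the remaining curves. *)
have [|rho Lrho rhoP] := @Lq_countable (fun n => if n is 0%N then g 0%N else rho1).
  by case.
exists rho => // c rc fin s t s0 st tL.
have /= f0 := rhoP c rc fin 0%N; have /= f1 := rhoP c rc fin 1%N.
have ug n : ug_along c u (g n).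
  by have [_] := svalP (rP n); apply => //; exact: rho1P.
have cp := arc_clamp_continuous rc.
have mg n : measurable_fun (`[s, t]%classic : set (measurableTypeR R)) (g n \o arc_clamp c).
  by apply: measurable_funTS; exact: continuous_borel_measurable.
have [] := @dominated_convergence _ _ _ (@lebesgue_measure R) `[s, t]%classic _
  (fun n => g n \o arc_clamp c) (gi \o arc_clamp c) (g 0%N \o arc_clamp c).
- by [].
- by [].
- by apply: measurable_funTS; exact: continuous_borel_measurable.
- by apply/nearW => r _; exact: cvg.
- apply/integrableP; split => //.
  have -> : (\int[mu1]_(x in `[s, t]) `|(g 0%N \o arc_clamp c) x| =
      \int[mu1]_(x in `[s, t]) g 0%N (arc_clamp c x))%E.
    by apply: eq_integral => x _; rewrite gee0_abs//; exact: g0.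
  apply: le_lt_trans f0; exact: le_path_integral_sub.
- apply/nearW => r n _; rewrite gee0_abs; last exact: g0.
  exact: (ndg _ 0%N n (leq0n n)).
move=> _ _ lim; apply: (@cvge_ge _ _ _ _ _ _ _ _ lim); last by apply/nearW => n; exact: ug.
Qed.

(** The difference is cut off to the set where f < g, since f is finite there. After the finite
    integral of f is cancelled, this difference has integral zero. *)
Lemma ae_le_of_integral (f g : XM -> \bar R) : measurable_fun setT f ->
    measurable_fun setT g -> (forall x, 0 <= f x)%E -> (forall x, f x <= g x)%E ->
    (\int[muM]_x g x <= \int[muM]_x f x)%E -> (\int[muM]_x f x < +oo)%E ->
  \forall x \ae muM, (g x <= f x)%E.
Proof.
move=> mf mg f0 fg le fin; pose N := [set x | (f x < g x)%E].
have mN : measurable N by have := measurable_lte measurableT mf mg; rewrite setTI.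
pose d := ((fun x => g x - f x)%E \_ N) : XM -> \bar R.
have d0 x : (0 <= d x)%E.
  apply: erestrict_ge0 => y Ny; have ff : f y \is a fin_num.
    by rewrite ge0_fin_numE// (lt_le_trans Ny)// leey.
  by rewrite sube_ge0 ?ltW ?ff ?orbT.
have md : measurable_fun setT d.
  have mgf : measurable_fun setT (fun x => g x - f x)%E by exact: emeasurable_funB.
  exact: (measurable_restrictT (T1 := XM) _ mN).1 (measurable_funTS mgf).
have gE x : (g x = f x + d x)%E.
  rewrite /d patchE; case: ifPn => [/set_mem/= fgx|].
    have ff : f x \is a fin_num by rewrite ge0_fin_numE// (lt_le_trans fgx)// leey.
    by rewrite addeC subeK.
  rewrite notin_setE /N/= => /negP; rewrite -leNgt adde0 => gf.
  by apply/eqP; rewrite eq_le gf fg.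
move: le; rewrite (eq_integral (fun x => f x + d x)%E); last by move=> x _; rewrite -gE.
rewrite ge0_integralD//.
have Ifin : (\int[muM]_x f x)%E \is a fin_num by rewrite ge0_fin_numE// integral_ge0.
rewrite -[leRHS]adde0 leeD2lE// => d_le0.
have : (\int[muM]_x `|d x| = 0)%E.
  under eq_integral do rewrite gee0_abs//.
  by apply/eqP; rewrite eq_le d_le0 integral_ge0.
move=> /(ae_eq_integral_abs muM measurableT md); apply: filterS => x /(_ Logic.I) dx.
by rewrite gE dx /= adde0.
Qed.

(** * The Dirichlet space and minimal weak upper gradients *)

Lemma dirichlet_weak u : dirichlet mu q u ->
  exists2 g, weak_upper_gradient mu q u g & Lq_borel g.
Proof.
move=> [_ [g [bg g0 ug] Lg]]; exists g; last exact/Lq_borelP.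
split => //; apply: (@exceptional_modulus0 _ (cst 0%E)).
  split => //.
    by apply/borel_funP; exact: measurable_cst.
  by under eq_integral do rewrite poweR0r//; rewrite integral0.
by move=> c [rc]; have := ug c rc.
Qed.

(** Adding the exceptional function rho to g gives a genuine upper gradient: on exceptional curves
    the right-hand side becomes infinite. *)
Lemma weak_dirichlet u g : measurable_fun [set: XM] (u : XM -> R) ->
  weak_upper_gradient mu q u g -> Lq_borel g -> dirichlet mu q u.
Proof.
move=> mu_ wg Lg; split => //; have [bg g0 _] := Lg.
have [rho Lrho rhoP] := (weak_upper_gradientP u bg g0).1 wg.
have [br r0 _] := Lrho.
have [bm m0 mq] := Lq_borel_maxe Lg Lrho.
have Ls : Lq_borel (fun x => g x + rho x)%E.
  apply: le_Lq_borel (Lq_borelZ (ler0n R 2) (Lq_borel_maxe Lg Lrho)) _ _ _ => [||x].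
  - by apply/borel_funP; apply: emeasurable_funD; exact/borel_funP.
  - by move=> x; rewrite adde_ge0.
  - by rewrite mule_natl mule2n leeD// le_max lexx ?orbT.
have [bs s0 _] := Ls.
exists (fun x => g x + rho x)%E; last exact/Lq_borelP.
split => // c rc.
have gs : (path_integral g c <= path_integral (fun x => g x + rho x)%E c)%E.
  by apply: le_path_integral => // x; rewrite leeDl.
have rs : (path_integral rho c <= path_integral (fun x => g x + rho x)%E c)%E.
  by apply: le_path_integral => // x; rewrite leeDr.
have [fin|] := ltP (path_integral rho c) +oo%E.
  by apply: le_trans gs; exact/ug_along_ineq/rhoP.
rewrite leye_eq => /eqP e; move: rs; rewrite e leye_eq /upper_gradient_ineq => /eqP ->.
exact: leey.
Qed.

(** The running minima of a minimizing sequence decrease to a gradient gi of least integral. For any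
    other gradient k, min(gi, k) is again a competitor, so its integral is not smaller, and this
    forces gi <= k almost everywhere. *)
Lemma min_weak_upper_gradient_exists u : dirichlet mu q u ->
  exists g, is_min_weak_upper_gradient mu q u g.
Proof.
move=> /dirichlet_weak[g1 wg1 Lg1].
pose V := [set Iq g | g in [set g | weak_upper_gradient mu q u g /\ Lq_borel g]].
have VI g : weak_upper_gradient mu q u g -> Lq_borel g -> (ereal_inf V <= Iq g)%E.
  by move=> wg Lg; apply: ereal_inf_lbound; exists g.
have I0 : (0 <= ereal_inf V)%E by apply: le_ereal_inf_tmp => _ [g _ <-]; exact: Iq_ge0.
have Ifin : ereal_inf V \is a fin_num.
  by rewrite ge0_fin_numE// (le_lt_trans (VI _ wg1 Lg1))//; case: Lg1.
have gP n : {g | [/\ weak_upper_gradient mu q u g, Lq_borel g &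
    (Iq g < ereal_inf V + (n.+1%:R^-1)%:E)%E]}.
  apply: cid; have e0 : 0 < n.+1%:R^-1 :> R by rewrite invr_gt0.
  by have [_ [g [wg Lg] <-] ?] := lb_ereal_inf_adherent e0 Ifin; exists g.
pose g n := sval (gP n).
pose h := fix h n := if n is n'.+1 then (fun x => mine (h n' x) (g n x)) else g 0%N.
have wLh n : weak_upper_gradient mu q u (h n) /\ Lq_borel (h n).
  elim: n => [|n [wh Lh]] /=; first by have [] := svalP (gP 0%N).
  have [wg Lg _] := svalP (gP n.+1); rewrite -/(g n.+1) in wg Lg.
  split; first exact: weak_upper_gradient_mine.
  have [bg g0 _] := Lg; have [bh h0 _] := Lh.
  apply: le_Lq_borel Lh _ _ _ => [||x]; last by rewrite ge_min lexx.
  - by apply/borel_funP; apply: measurable_mine; exact/borel_funP.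
  - by move=> x; rewrite le_min g0 h0.
have hg n x : (h n x <= g n x)%E by case: n => //= n; rewrite ge_min lexx orbT.
have ndh x : nonincreasing_seq (h ^~ x).
  by apply/nonincreasing_seqP => n /=; rewrite ge_min lexx.
have [wi Li] := weak_upper_gradient_lim (fun n => (wLh n).1) (fun n => (wLh n).2) ndh.
set gi := (fun x => ereal_inf _) in wi Li.
have [bi i0 qi] := Li.
have giI : (Iq gi <= ereal_inf V)%E.
  apply/lee_addgt0Pr => e e0.
  have [n _ /(_ n (leqnn _)) /= ne] := near_infty_natSinv_lt (PosNum e0).
  have [_ Lg /ltW lt_n] := svalP (gP n); rewrite -/(g n) in Lg lt_n.
  have [bg _ _] := Lg.
  apply: (@le_trans _ _ (Iq (g n))).
    apply: le_Iq => // x; apply: le_trans (hg n x).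
    by apply: ereal_inf_lbound; exists n.
  by apply: le_trans lt_n _; rewrite leeD2l// lee_fin ltW.
exists gi; split => //; first exact/Lq_borelP.
move=> k wk Lk; have [bk k0 _] := wk; move/(Lq_borelP bk k0) : Lk => Lk.
have wm := weak_upper_gradient_mine wi wk Li Lk.
have mle x : (mine (gi x) (k x) <= gi x)%E by rewrite ge_min lexx.
have m0 x : (0 <= mine (gi x) (k x))%E by rewrite le_min i0 k0.
have bm : borel_fun (fun x => mine (gi x) (k x)).
  by apply/borel_funP; apply: measurable_mine; exact/borel_funP.
have Lm := le_Lq_borel Li bm m0 mle; have [_ _ mq] := Lm.
have := @ae_le_of_integral (fun x => mine (gi x) (k x) `^ q)%E (fun x => gi x `^ q)%E
  (borel_cara_pow bm) (borel_cara_pow bi) (fun x => poweR_ge0 _ _)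
  (fun x => le_poweR (m0 x) (mle x)) (le_trans giI (VI _ wm Lm)) mq.
apply: filterS => x le_x; rewrite leNgt; apply/negP => kg; move: le_x.
rewrite min_r ?(ltW kg)// leNgt => /negP; apply.
have kfin : k x \is a fin_num by rewrite ge0_fin_numE// (lt_le_trans kg)// leey.
rewrite lt_neqAle le_poweR ?k0 ?(ltW kg)// andbT; apply/eqP => e.
have : ((k x `^ q) `^ q^-1 = (gi x `^ q) `^ q^-1)%E by rewrite e.
by rewrite -!poweRrM divff// !poweRe1// => e'; move: kg; rewrite e' ltxx.
Qed.

Lemma min_weak_upper_gradientP u : dirichlet mu q u ->
  is_min_weak_upper_gradient mu q u (min_weak_upper_gradient mu q u).
Proof.
move=> /min_weak_upper_gradient_exists[g gP].
by rewrite /min_weak_upper_gradient; exact: (xgetPex (cst +oo%E) (ex_intro _ g gP)).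
Qed.

End lebesgue_borel.

(** * Lipschitz functions *)

Section lipschitz.
Context {R : realType} {Y : metricType R}.
Implicit Types (u : Y -> R) (y z : Y).

Lemma lip_const_le u (L : R) : 0 <= L ->
  (forall y z, `|u y - u z| <= L * mdist y z) -> lip_const u <= L.
Proof.
move=> L0 uL; rewrite /lip_const; set S := [set r | _].
(* Without two distinct points the supremum is over the empty set and equals 0. *)
have [e|S0] := eqVneq S set0; first by rewrite e sup0.
apply: ge_sup; first exact/set0P.
move=> _ [y [z [yz ->]]]; rewrite ler_pdivrMr ?mdist_gt0//; exact: uL.
Qed.

Lemma lip_const_ge0 u : is_lipschitz u -> 0 <= lip_const u.
Proof.
move=> [L uL]; rewrite /lip_const; set S := [set r | _].
have [e|/set0P[r0 [y [z [yz _]]]]] := eqVneq S set0; first by rewrite e sup0.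
apply: (@le_trans _ _ (`|u y - u z| / mdist y z)); first by rewrite divr_ge0 ?mdist_ge0.
apply: ub_le_sup; last by exists y, z.
exists L => _ [y' [z' [yz' ->]]]; rewrite ler_pdivrMr ?mdist_gt0//; exact: uL.
Qed.

Lemma lip_constP u : is_lipschitz u ->
  forall y z, `|u y - u z| <= lip_const u * mdist y z.
Proof.
move=> [L uL] y z; have [->|yz] := eqVneq y z; first by rewrite subrr normr0 mdistxx mulr0.
rewrite -ler_pdivrMr ?mdist_gt0//; apply: ub_le_sup; last by exists y, z.
exists L => _ [y' [z' [yz' ->]]]; rewrite ler_pdivrMr ?mdist_gt0//; exact: uL.
Qed.

Lemma mdist_lip z x y : `|mdist x z - mdist y z| <= 1 * mdist x y.
Proof.
rewrite mul1r; have := metric_triangle x y z; have := metric_triangle y x z.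
by rewrite (metric_sym y x) ler_norml; lra.
Qed.

Lemma lipschitz_continuous u (L : R) :
  (forall y z, `|u y - u z| <= L * mdist y z) -> continuous u.
Proof.
move=> uL y; apply/cvgrPdist_lt => e e0; near=> z.
apply: le_lt_trans (uL _ _) _.
have : mdist y z < e / (1 + `|L|).
  near: z; apply: (@metricType_numDomainType.cvgr_dist_lt _ _ _ _ _ id y) => //.
  by rewrite divr_gt0// ltr_wpDr.
rewrite ltr_pdivlMr ?ltr_wpDr// => lt_e; apply: le_lt_trans lt_e.
have := ler_norm L; have := mdist_ge0 y z; have := normr_ge0 L; nra.
Unshelve. all: by end_near. Qed.

End lipschitz.

(** * Local isometries of the line and test functions *)

Lemma norm_locally_isometric {R : realType} (a : R) :
  exists2 h, 0 < h & forall b : R, `|b - a| < h -> `| `|b| - `|a| | = `|b - a|.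
Proof.
(* The corner at 0 is harmless, because only distances to the centre a are compared. *)
have [->|a0] := eqVneq a 0.
  by exists 1 => // b _; rewrite normr0 !subr0 normr_id.
exists `|a|; rewrite ?normr_gt0// => b.
case: (ltP 0 a) => a0'.
  rewrite (gtr0_norm a0') ltr_norml => /andP[? ?].
  by rewrite (gtr0_norm (x := b))//; lra.
have {}a0 : a < 0 by rewrite lt_neqAle a0.
rewrite (ltr0_norm a0) ltr_norml => /andP[? ?].
rewrite (ltr0_norm (x := b)); last lra.
by rewrite -opprB opprK opprD opprK -normrN; congr `|_|; lra.
Qed.

(* The triangle wave: the distance to the lattice of even multiples of d. *)
Lemma triangle_wave {R : realType} (d : R) : 0 < d ->
  exists s : R -> R, (forall a, 0 <= s a <= d) /\
    forall a, exists2 h, 0 < h & forall b, `|b - a| < h -> `|s b - s a| = `|b - a|.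
Proof.
move=> d0; pose m (a : R) : R := (Num.floor ((a + d) / (2 * d)))%:~R.
pose s a := `|a - 2 * d * m a|.
have dd0 : 0 < 2 * d by rewrite mulr_gt0.
have mP a : - d <= a - 2 * d * m a < d.
  have := floor_le ((a + d) / (2 * d)); have := lt_succ_floor ((a + d) / (2 * d)).
  rewrite -/(m a) intrD -/(m a) ltr_pdivrMr// ler_pdivlMr// => ? ?; apply/andP; split; lra.
have mE a (k : int) : - d <= a - 2 * d * k%:~R < d -> m a = k%:~R.
  move=> /andP[k1 k2]; rewrite /m (@floor_def _ _ k)//.
  by rewrite intrD ler_pdivlMr// ltr_pdivrMr//; apply/andP; split; lra.
exists s; split.
  move=> a; rewrite /s normr_ge0/= ler_norml; have /andP[? ?] := mP a.
  by apply/andP; split; lra.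
move=> a; have /andP[a1 a2] := mP a; move: a1; rewrite le_eqVlt => /predU1P[a1|a1].
  (* Here a is a crest of the wave, midway between two lattice points: to the left of a the nearest
     one is given by [m a - 1]. *)
  exists d => // b; rewrite ltr_norml => /andP[b1 b2].
  rewrite /s -a1 normrN (gtr0_norm d0).
  case: (leP a b) => ab.
    have -> : m b = m a by apply: mE; apply/andP; split; rewrite -/(m a); lra.
    rewrite (ler0_norm (x := b - 2 * d * m a)); last lra.
    by rewrite -[in RHS]normrN; congr `|_|; lra.
  have -> : m b = m a - 1.
    pose k := Num.floor ((a + d) / (2 * d)).
    have e : m a - 1 = (k - 1)%:~R by rewrite intrB.
    rewrite e; apply: mE; rewrite -e mulrBr mulr1; apply/andP; split; lra.
  rewrite (ger0_norm (x := b - 2 * d * (m a - 1))); last lra.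
  by congr `|_|; lra.
(* Away from the crests m is constant near a, and s is a translate of the absolute value. *)
have [h h0 hP] := norm_locally_isometric (a - 2 * d * m a).
exists (Num.min h (Num.min (a - 2 * d * m a + d) (d - (a - 2 * d * m a)))).
  by rewrite !lt_min h0/=; apply/andP; split; lra.
move=> b; rewrite !lt_min => /and3P[bh b1 b2].
have mb : m b = m a.
  apply: mE; rewrite -/(m a); move: b1 b2; rewrite !ltr_norml => /andP[? ?] /andP[? ?].
  by apply/andP; split; lra.
have e : b - 2 * d * m a - (a - 2 * d * m a) = b - a by lra.
by rewrite /s mb -e; apply: hP; rewrite e.
Qed.

(** This is [local_growth] with the identity as the comparison function. *)
Lemma locally_isometric_lip {R : realType} (s : R -> R) :
    (forall a, exists2 h, 0 < h & forall b, `|b - a| < h -> `|s b - s a| = `|b - a|) ->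
  forall a b, `|s a - s b| <= `|a - b|.
Proof.
move=> loc a b; wlog ab : a b / a <= b.
  by move=> H; case: (leP a b) => [/H//|/ltW/H]; rewrite distrC [leRHS]distrC.
rewrite distrC (distrC a) (ger0_norm (x := b - a)) ?subr_ge0//.
apply: (@local_growth _ a b s id) => // t _.
by have [h h0 hP] := loc t; exists h => // r _ rt; rewrite hP.
Qed.

(** Take the supremum of 0 and of all min(s(d(., z i)), 2 d - d(., x)) with x in [K i]; each is
    1-Lipschitz. Within d of a point of [K i] the second entry exceeds d and is inactive for that
    point, while the terms of any other [K j], at distance more than 3 d, are negative. *)
Lemma separated_gluing {R : realType} {Y : metricType R} (n : nat) (z : nat -> Y)
    (K : nat -> set Y) (d : R) (s : R -> R) : 0 < d ->
    (forall a, 0 <= s a <= d) -> (forall a b, `|s a - s b| <= `|a - b|) ->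
    (forall i j x y, (i < n)%N -> (j < n)%N -> i != j -> K i x -> K j y ->
      4 * d <= mdist x y) ->
  exists u : Y -> R, (forall y y', `|u y - u y'| <= 1 * mdist y y') /\
    forall i y x, (i < n)%N -> K i x -> mdist y x < d -> u y = s (mdist y (z i)).
Proof.
move=> d0 s0d sL sep.
pose S y := [set r | r = 0 \/ exists i x, [/\ (i < n)%N, K i x &
  r = Num.min (s (mdist y (z i))) (2 * d - mdist y x)]].
have S0 y : S y 0 by left.
have ubS y : ubound (S y) d.
  move=> _ [->|[i [x [_ _ ->]]]]; first exact: ltW.
  by rewrite ge_min; have /andP[_ ->] := s0d (mdist y (z i)).
have hS y : has_sup (S y) by split; [exists 0|exists d].
exists (fun y => sup (S y)); split.
  have H y y' : sup (S y) <= sup (S y') + mdist y y'.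
    apply: ge_sup => [|_ [->|[i [x [ilt Kx ->]]]]]; first by exists 0.
      rewrite addr_ge0 ?mdist_ge0//; apply: ub_le_sup => //; by exists d.
    rewrite -lerBlDr; apply: (@le_trans _ _ (Num.min (s (mdist y' (z i))) (2 * d - mdist y' x))).
      rewrite le_min; apply/andP; split.
        rewrite lerBlDl; apply: (@le_trans _ _ (s (mdist y (z i)))).
          by rewrite ge_min lexx.
        have := sL (mdist y (z i)) (mdist y' (z i)).
        have := mdist_lip (z i) y y'; rewrite mul1r => h1 h2.
        by have := le_trans h2 h1; rewrite ler_norml => /andP[_]; lra.
      rewrite lerBlDl; apply: (@le_trans _ _ (2 * d - mdist y x)).
        by rewrite ge_min lexx orbT.
      by have := metric_triangle y' y x; rewrite (metric_sym y' y); lra.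
    by apply: ub_le_sup; [exists d|right; exists i, x].
  move=> y y'; rewrite mul1r; have := H y y'; have := H y' y.
  by rewrite (metric_sym y' y) ler_norml; lra.
move=> i y x ilt Kx yx; have /andP[s0 sd] := s0d (mdist y (z i)).
apply/eqP; rewrite eq_le; apply/andP; split.
  apply: ge_sup => [|_ [->//|[j [x' [jlt Kx' ->]]]]]; first by exists 0.
  rewrite ge_min; have [->|ij] := eqVneq j i; first by rewrite lexx.
  apply/orP; right; apply: le_trans s0.
  have := sep _ _ _ _ jlt ilt ij Kx' Kx; have := metric_triangle x' y x.
  by rewrite (metric_sym x' y); lra.
apply: ub_le_sup; first by exists d.
by right; exists i, x; split => //; rewrite min_l//; lra.
Qed.

Lemma separable_seq {R : realType} {Y : metricType R} (y0 : Y) : separable Y ->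
  exists z : nat -> Y, forall y (e : R), 0 < e -> exists i, mdist y (z i) < e.
Proof.
move=> [D cD dD].
(* An empty D is not dense because y0 exists; otherwise D is the range of a sequence. *)
have [D0|[f]] := pfcard_geP cD.
  have := dD setT (ex_intro _ y0 Logic.I) openT.
  by rewrite D0 setI0 => -[].
exists f => y e e0.
have [|x [yx Dx]] := dD (ball y e)° _ (open_interior _).
  by exists y; exact: nbhsx_ballx.
have /(_ x Dx)[i _ ix] := @surj _ _ _ _ f; exists i; rewrite ix.
by move: (interior_subset yx); rewrite ballEmdist.
Qed.

(** * Running maxima and the supremum of a sequence *)

Section running_max.
Context {R : realType} {X : pmetricType R}.
Variable g : nat -> X -> \bar R.
Hypotheses (bg : forall n, borel_fun (g n)) (g0 : forall n x, (0 <= g n x)%E).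

Fixpoint running_max n x : \bar R :=
  if n is m.+1 then maxe (running_max m x) (g m x) else 0%E.

Lemma borel_running_max n : borel_fun (running_max n).
Proof.
elim: n => [|n ih]; first by apply/borel_funP; exact: measurable_cst.
by apply/borel_funP; apply: measurable_maxe; exact/borel_funP.
Qed.

Lemma running_max_ge0 n x : (0 <= running_max n x)%E.
Proof. by elim: n => //= n ih; rewrite le_max ih. Qed.

Lemma nondecreasing_running_max x : nondecreasing_seq (running_max ^~ x).
Proof. by apply/nondecreasing_seqP => n /=; rewrite le_max lexx. Qed.

Lemma le_running_max i n x : (i < n)%N -> (g i x <= running_max n x)%E.
Proof.
move=> ilt; apply: le_trans (nondecreasing_running_max x ilt).
by rewrite /= le_max lexx orbT.
Qed.

(** Written through the running maxima, so that it is an increasing limit and monotone convergence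
    applies. *)
Definition seq_sup x := ereal_sup (range (running_max ^~ x)).

Lemma cvg_running_max x : running_max n x @[n --> \oo] --> seq_sup x.
Proof. exact/ereal_nondecreasing_cvgn/nondecreasing_running_max. Qed.

Lemma borel_seq_sup : borel_fun seq_sup.
Proof.
apply/borel_funP.
apply: (@emeasurable_fun_cvg _ (borel_type X) R setT running_max) => [n|x _].
  by apply/borel_funP; exact: borel_running_max.
exact: cvg_running_max.
Qed.

Lemma le_seq_sup i x : (g i x <= seq_sup x)%E.
Proof.
apply: le_trans (le_running_max x (ltnSn i)) _.
by apply: ereal_sup_ubound; exists i.+1.
Qed.

Lemma seq_sup_ge0 x : (0 <= seq_sup x)%E.
Proof. exact: le_trans (g0 0%N x) (le_seq_sup 0%N x). Qed.

Lemma seq_sup_le x (a : \bar R) : (forall i, g i x <= a)%E -> (seq_sup x <= a)%E.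
Proof.
move=> ga; apply: ge_ereal_sup => _ [n _ <-].
elim: n => [|n ih] /=; first exact: le_trans (g0 0%N x) (ga 0%N).
by rewrite ge_max ih ga.
Qed.

(* The points where the maximum of the first n functions is positive and first
   attained by the i-th one. *)
Definition max_set n i := [set x | (running_max i x < g i x)%E /\
  (running_max n x <= g i x)%E].

Lemma borel_max_set n i : borel_set (max_set n i).
Proof.
have bm k : measurable_fun [set: borel_type X] (running_max k).
  by apply/borel_funP; exact: borel_running_max.
have bgi : measurable_fun [set: borel_type X] (g i) by exact/borel_funP.
have m1 := @measurable_lte _ (borel_type X) R setT measurableT _ _ (bm i) bgi.
have m2 := @measurable_lee _ (borel_type X) R setT measurableT _ _ (bm n) bgi.
by have := measurableI _ _ m1 m2; rewrite !setTI.
Qed.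

Lemma trivIset_max_set n : trivIset `I_n (max_set n).
Proof.
have H i j : (i < j)%N -> (j < n)%N -> forall x, max_set n i x -> max_set n j x -> False.
  move=> ij jn x [_ wi] [wj _]; move: wj; rewrite ltNge => /negP; apply.
  apply: le_trans (le_running_max x jn) (le_trans wi _).
  exact: le_running_max.
move=> i j /= ilt jlt [x [xi xj]]; have [ij|ji|//] := ltngtP i j.
- by case: (H _ _ ij jlt x xi xj).
- by case: (H _ _ ji ilt x xj xi).
Qed.

Lemma max_set_cover n x : (0 < running_max n x)%E ->
  exists2 i, (i < n)%N & max_set n i x.
Proof.
rewrite /max_set /=; elim: n => [|n ih] /=; first by rewrite ltxx.
case: (leP (g n x) (running_max n x)) => le_n.
  by move=> /ih[i ilt [wi wn]]; exists i => //; exact: ltnW.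
by move=> _; exists n.
Qed.

End running_max.

(** * Composition operators *)

Section composition.
Context {R : realType} {X : pmetricType R} (mu : {outer_measure set X -> \bar R}).
Hypothesis hb : forall B, borel_set B -> mu.-caratheodory B.
Variable q : R.
Hypothesis q1 : 1 <= q.
Let XM := caratheodory_type mu.
Let muM : {measure set XM -> \bar R} := cara_measure mu.
Local Notation Iq g := (\int[muM]_x (g x `^ q))%E.
Local Notation Nq g := ('N[muM]_(q%:E)[g])%E.

Let q0 : 0 < q. Proof. exact: lt_le_trans q1. Qed.
Let qn0 : q != 0. Proof. exact: lt0r_neq0. Qed.

Lemma continuous_cara_measurable (v : X -> R) : continuous v ->
  measurable_fun [set: XM] (v : XM -> R).
Proof.
move=> /continuousP cv; apply: (measurability _ (RGenOpens.measurableE R)).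
move=> _ [_ [a [b ->] <-]]; rewrite setTI; apply: hb; apply: open_borel.
exact/cv/interval_open.
Qed.

Lemma ae_mono (P Q : XM -> Prop) : (forall x, P x -> Q x) ->
  (\forall x \ae muM, P x) -> \forall x \ae muM, Q x.
Proof. by move=> PQ; apply: filterS. Qed.

Lemma Lnorm_powq (g : X -> \bar R) : (forall x, 0 <= g x)%E -> (Nq g `^ q = Iq g)%E.
Proof.
by move=> g0; rewrite poweR_Lnorm//; apply: eq_integral => x _; rewrite gee0_abs.
Qed.

Lemma Lnorm_le_EFin (g : X -> \bar R) (C : R) : (forall x, 0 <= g x)%E -> 0 <= C ->
  (Nq g <= C%:E)%E = (Iq g <= (C `^ q)%:E)%E.
Proof.
move=> g0 C0; rewrite -Lnorm_powq//; have N0 := Lnorm_ge0 muM q%:E g.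
apply/idP/idP => [le|].
  by have := le_poweR q1 N0 le.
move=> le; have : ((Nq g `^ q) `^ q^-1 <= (C `^ q)%:E `^ q^-1)%E.
  apply: gt0_ler_poweR; rewrite ?invr_ge0 ?(ltW q0)// in_itv/= leey.
  - by rewrite poweR_ge0.
  - by rewrite lee_fin powR_ge0.
by rewrite -poweR_EFin -!poweRrM divff// !poweRe1.
Qed.

(** * The supremum of countably many gradients as a majorant *)

Section majorant.
Context {Y : metricType R}.
Variable phi : X -> Y.
Hypothesis cphi : continuous phi.
Variable z : nat -> Y.
Hypothesis dz : forall y (e : R), 0 < e -> exists i, mdist y (z i) < e.

Let v (y : Y) (x : X) : R := mdist (phi x) y.

Hypothesis dirv : forall i, dirichlet mu q (v (z i)).

Let g i := min_weak_upper_gradient mu q (v (z i)).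

Let gP i : is_min_weak_upper_gradient mu q (v (z i)) (g i).
Proof. exact: min_weak_upper_gradientP. Qed.

Let bg i : borel_fun (g i). Proof. by have [[]] := gP i. Qed.
Let g0 i x : (0 <= g i x)%E. Proof. by have [[_ H _] _ _] := gP i; exact: H. Qed.
Let Lg i : Lq_borel mu q (g i).
Proof. by have [_ Lgi _] := gP i; apply/(Lq_borelP hb q1). Qed.

Let w := seq_sup g.
Let bw : borel_fun w. Proof. exact: borel_seq_sup. Qed.
Let w0 x : (0 <= w x)%E. Proof. exact: seq_sup_ge0. Qed.

Lemma continuous_comp_lip (u : Y -> R) (L : R) :
  (forall y y', `|u y - u y'| <= L * mdist y y') -> continuous (u \o phi).
Proof.
move=> uL x; apply: continuous_comp; first exact: cphi.
exact: lipschitz_continuous uL _.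
Qed.

Section integrable_sup.
Hypothesis Lw : Lq_borel mu q w.

(** If [z i] is within e/2 of the image of one end point, the distance of the two images exceeds the
    increment of d(phi, z i) by at most e. One exceptional function serves all i. *)
Lemma seq_sup_metric_gradient : exists2 rho, Lq_borel mu q rho &
  forall c, rectifiable c -> (path_integral rho c < +oo)%E ->
  forall s t : R, 0 <= s -> s <= t -> t <= fine (curve_length c) ->
  ((mdist (phi (arc_clamp c s)) (phi (arc_clamp c t)))%:E <=
   \int[mu1]_(r in `[s, t]) w (arc_clamp c r))%E.
Proof.
have rP i : {rho | Lq_borel mu q rho /\ forall c, rectifiable c ->
    (path_integral rho c < +oo)%E -> ug_along c (v (z i)) (g i)}.
  apply: cid; have [wg _ _] := gP i.
  by have [rho ? ?] := (weak_upper_gradientP hb q1 _ (bg i) (g0 i)).1 wg; exists rho.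
have [|rho Lrho rhoP] := @Lq_countable _ _ _ hb _ q1 (fun i => sval (rP i)).
  by move=> i; have [] := svalP (rP i).
exists rho => // c rc fin s t s0 st tL.
have cp := arc_clamp_continuous rc.
have ug i : (`|v (z i) (arc_clamp c s) - v (z i) (arc_clamp c t)|%:E <=
    \int[mu1]_(r in `[s, t]) w (arc_clamp c r))%E.
  have [_ H] := svalP (rP i).
  apply: le_trans (H c rc (rhoP c rc fin i) s t s0 st tL) _.
  apply: ge0_le_integral => //.
  - by apply: measurable_funTS; exact: continuous_borel_measurable.
  - by apply: measurable_funTS; exact: continuous_borel_measurable.
  - by move=> r _; exact: le_seq_sup.
apply/lee_addgt0Pr => e e0.
have [i] := dz (phi (arc_clamp c s)) (divr_gt0 e0 (ltr0n R 2)).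
have := ug i; rewrite /v; set a := phi _; set b := phi _ => ugi ai.
apply: (@le_trans _ _ (`|mdist a (z i) - mdist b (z i)|%:E + e%:E)%E); last first.
  by rewrite leeD2r.
rewrite -EFinD lee_fin.
have := metric_triangle a (z i) b; rewrite (metric_sym (z i) b).
have := ler_norm (- (mdist a (z i) - mdist b (z i))); rewrite normrN.
lra.
Qed.

Lemma comp_weak_upper_gradient (u : Y -> R) (L : R) : 0 <= L ->
    (forall y y', `|u y - u y'| <= L * mdist y y') ->
  weak_upper_gradient mu q (u \o phi) (fun x => L%:E * w x)%E.
Proof.
move=> L0 uL; apply/(weak_upper_gradientP hb q1) => //.
- exact: borel_funZ.
- by move=> x; rewrite mule_ge0.
have [rho Lrho rhoP] := seq_sup_metric_gradient.
exists rho => // c rc fin s t s0 st tL.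
rewrite ge0_integralZl_EFin//; last first.
  apply: measurable_funTS; apply: continuous_borel_measurable => //.
  exact: arc_clamp_continuous.
apply: (@le_trans _ _ (L%:E * (mdist (phi (arc_clamp c s)) (phi (arc_clamp c t)))%:E)%E).
  by rewrite -EFinM lee_fin uL.
by rewrite lee_wpmul2l// rhoP.
Qed.

Lemma comp_dirichlet (u : Y -> R) (L : R) : 0 <= L ->
    (forall y y', `|u y - u y'| <= L * mdist y y') ->
  dirichlet mu q (u \o phi) /\
  \forall x \ae muM, (min_weak_upper_gradient mu q (u \o phi) x <= L%:E * w x)%E.
Proof.
move=> L0 uL; have wL := comp_weak_upper_gradient L0 uL.
have LL := Lq_borelZ hb L0 Lw; have [bL L0' _] := LL.
have dir : dirichlet mu q (u \o phi).
  apply: (weak_dirichlet hb q1 _ wL LL).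
  exact/continuous_cara_measurable/continuous_comp_lip.
split => //; have [_ _ H] := min_weak_upper_gradientP hb q1 dir.
by apply: H => //; exact/(Lq_borelP hb q1).
Qed.

Lemma seq_sup_composition_bound : composition_bound mu q phi (fine (Nq w)).
Proof.
have [_ _ fw] := Lw.
have Nfin : Nq w \is a fin_num.
  by rewrite ge0_fin_numE ?Lnorm_ge0//; exact: (in_Lq_ge0P mu q1 w0).2.
have N0 : 0 <= fine (Nq w) by rewrite fine_ge0// Lnorm_ge0.
split => // u ul; have K0 := lip_const_ge0 ul.
have [dir le] := comp_dirichlet K0 (lip_constP ul).
have [[bm m0 _] _ _] := min_weak_upper_gradientP hb q1 dir.
rewrite Lnorm_le_EFin//; last by rewrite mulr_ge0.
rewrite powRM// EFinM muleC.
have -> : ((fine (Nq w) `^ q)%:E = Iq w)%E by rewrite -poweR_EFin fineK// Lnorm_powq.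
rewrite -(IqZ hb)//; apply: ae_ge0_le_integral => //.
- by move=> x _; exact: poweR_ge0.
- exact: borel_cara_pow.
- by move=> x _; exact: poweR_ge0.
- by apply: borel_cara_pow => //; exact: borel_funZ.
by move: le; apply: ae_mono => x le _; exact: le_poweR.
Qed.

(** Distances to arbitrary points are 1-Lipschitz, so w majorizes all their gradients, not only
    those of the dense sequence. Any other majorant dominates all the [g i] off one null set, hence
    also their supremum. *)
Lemma seq_sup_min_majorant : is_min_reshetnyak_majorant mu q phi w.
Proof.
split.
  split => //; first exact/(Lq_borelP hb q1).
  move=> y; have [dir le] := comp_dirichlet ler01 (mdist_lip y).
  by split => //; move: le; apply: ae_mono => x; rewrite mul1e.
move=> w' [_ _ w'P].
have : \forall x \ae muM, forall i, (g i x <= w' x)%E.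
  by apply/ae_foralln => i; have [] := w'P (z i).
by apply: ae_mono => x; exact: seq_sup_le.
Qed.

End integrable_sup.

(** * An operator bound controls the integral of the majorant *)

Section norm_bound.
Variable C : R.
Hypothesis bC : composition_bound mu q phi C.
Hypothesis dirL : forall u : Y -> R, is_lipschitz u -> dirichlet mu q (u \o phi).
Variable psi : Y -> X.
Hypotheses (phiK : cancel phi psi) (cpsi : continuous psi).

(** A single 1-Lipschitz function u tests all i at once: the minimal gradient h of u o phi dominates
    [g i] almost everywhere on [K i], and the sets [K i] are disjoint, so the sum is at most the
    integral of h^q. *)
Lemma separated_sum_le (n : nat) (K : nat -> set X) (d : R) : 0 < d ->
    (forall i, borel_set (K i)) ->
    (forall i j x y, (i < n)%N -> (j < n)%N -> i != j -> K i x -> K j y ->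
      4 * d <= mdist (phi x) (phi y)) ->
  (\sum_(i <- iota 0 n) \int[muM]_(x in K i) (g i x `^ q) <= (C `^ q)%:E)%E.
Proof.
move=> d0 bK sep; have [C0 CP] := bC.
have [s [s0d loc]] := triangle_wave d0.
have sL := locally_isometric_lip loc.
have [|u [uL uE]] := @separated_gluing _ _ n z (fun i => phi @` K i) d s d0 s0d sL.
  by move=> i j _ _ ilt jlt ij [x Kx <-] [y Ky <-]; exact: sep ij Kx Ky.
have ul : is_lipschitz u by exists 1.
have diru := dirL ul.
pose h := min_weak_upper_gradient mu q (u \o phi).
have [wh Lh _] := min_weak_upper_gradientP hb q1 diru; rewrite -/h in wh Lh.
have [bh h0 _] := wh; move/(Lq_borelP hb q1 bh h0) : Lh => Lh.
have hC : (Iq h <= (C `^ q)%:E)%E.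
  rewrite -Lnorm_le_EFin//; apply: le_trans (CP u ul) _.
  by rewrite lee_fin ler_piMr// (lip_const_le ler01).
have gh i : (i < n)%N -> \forall x \ae muM, K i x -> (g i x <= h x)%E.
  move=> ilt; pose V := phi @^-1` (\bigcup_(y in phi @` K i) (ball y d)°).
  have oV : open V.
    move/continuousP : cphi; apply; apply: bigcup_open => y _.
    exact: open_interior.
  have Vu x : V x -> u (phi x) = s (mdist (phi x) (z i)).
    move=> [y Ky /interior_subset]; rewrite ballEmdist/= metric_sym => yx.
    exact: (uE i (phi x) y ilt Ky yx).
  (* On V the increments of d(phi, z i) and of u o phi agree locally in absolute value, so h may
     replace [g i] there; minimality of [g i] then gives [g i] <= h on V. *)
  have wG : weak_upper_gradient mu q (v (z i)) (fun x => if x \in V then h x else g i x).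
    have [wgi _ _] := gP i.
    apply: (weak_upper_gradient_glue hb q1 wgi (Lg i) Lh (open_borel oV)).
    have [rho Lrho rhoP] := (weak_upper_gradientP hb q1 _ bh h0).1 wh.
    exists rho => // c rc fin t tL Vt.
    have cp := arc_clamp_continuous rc.
    have [h1 h10 h1P] := continuous_open_near cp oV Vt.
    have [h2 h20 h2P] := loc (v (z i) (arc_clamp c t)).
    have cv : continuous (v (z i) \o arc_clamp c).
      move=> r; apply: continuous_comp; first exact: cp.
      exact: (continuous_comp_lip (mdist_lip (z i))).
    have /cvgrPdist_lt/(_ _ h20)/nbhs_ballP[h3 /= h30 h3P] := cv t.
    exists (Num.min h1 h3); first by rewrite lt_min h10.
    move=> r rL; rewrite lt_min => /andP[rt1 rt3].
    have vrt : `|v (z i) (arc_clamp c r) - v (z i) (arc_clamp c t)| < h2.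
      by rewrite distrC; apply: h3P; rewrite /ball/= distrC.
    rewrite -h2P// /v -!Vu//; last exact: h1P.
    by apply: (ug_along_sym (u := u \o phi)) => //; exact: rhoP.
  have LG : Lq_borel mu q (fun x => if x \in V then h x else g i x).
    apply: (le_Lq_borel hb q1 (Lq_borel_maxe hb Lh (Lg i))).
    - by apply: borel_fun_patch => //; exact: open_borel.
    - by move=> x; case: ifPn.
    - by move=> x; case: ifPn => _; rewrite le_max lexx ?orbT.
  have [bG G0 _] := LG; have [_ _ H] := gP i.
  have := H _ wG ((Lq_borelP hb q1 bG G0).2 LG); apply: ae_mono => x le_x Kx.
  move: le_x; rewrite mem_set//; exists (phi x); first by exists x.
  exact: nbhsx_ballx.
apply: le_trans hC.
have mK i : measurable (K i : set XM) by exact: hb.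
have mh : measurable_fun [set: XM] (fun x => h x `^ q)%E by exact: borel_cara_pow.
have h0q x : (0 <= h x `^ q)%E by exact: poweR_ge0.
apply: (@le_trans _ _ (\sum_(i <- iota 0 n) \int[muM]_(x in K i) (h x `^ q))%E).
  rewrite [leLHS]big_seq [leRHS]big_seq.
  apply: lee_sum => i; rewrite mem_iota add0n => /andP[_ ilt].
  apply: ae_ge0_le_integral.
  - exact: mK.
  - by move=> x _; exact: poweR_ge0.
  - by apply: measurable_funTS; exact: borel_cara_pow.
  - by move=> x _; exact: h0q.
  - exact: measurable_funTS mh.
  by have := gh i ilt; apply: ae_mono => x H /H; exact: le_poweR.
rewrite -ge0_integral_bigsetU//.
- apply: ge0_subset_integral => //.
  by apply: bigsetU_measurable => i _; exact: mK.
- exact: iota_uniq.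
- move=> i j /=; rewrite !mem_iota !add0n => /andP[_ ilt] /andP[_ jlt] [x [Kx Kx']].
  apply/eqP/negPn/negP => ij; have := sep i j x x ilt jlt ij Kx Kx'.
  by rewrite mdistxx leNgt mulr_gt0.
- exact: measurable_funTS.
Qed.

(** Shrink each [A i] to a closed [F i], then to a subset [K i] whose image keeps away from those of
    the other [F j], with small loss of integral, and apply [separated_sum_le]. *)
Lemma disjoint_sum_le (n : nat) (A : nat -> set X) : (forall i, borel_set (A i)) ->
    trivIset `I_n A ->
  (\sum_(i <- iota 0 n) \int[muM]_(x in A i) (g i x `^ q) <= (C `^ q)%:E)%E.
Proof.
move=> bA tA.
(* The sum of all densities defines one finite measure m that bounds each of the integrals, so all
   losses are measured by m. *)
pose k x := (\sum_(i <- iota 0 n) g i x `^ q)%E.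
have mk : measurable_fun [set: XM] k.
  by apply: emeasurable_sum => i; exact: borel_cara_pow.
have k0 x : (0 <= k x)%E by apply: sume_ge0 => i _; exact: poweR_ge0.
have [m mE] := density_measure muM mk k0.
have mT : (m setT < +oo)%E.
  rewrite mE ge0_integral_sum//; last 2 first.
  - by move=> i; exact: borel_cara_pow.
  - by move=> i x _; exact: poweR_ge0.
  by apply: lte_sum_pinfty => i _; have [] := Lg i.
have gm i B : (i < n)%N -> borel_set B ->
    (\int[muM]_(x in B) (g i x `^ q) <= m B)%E.
  move=> ilt bB; rewrite mE; apply: ge0_le_integral => //.
  - exact: hb.
  - by move=> x _; exact: poweR_ge0.
  - by apply: measurable_funTS; exact: borel_cara_pow.
  - exact: measurable_funTS.
  move=> x _; rewrite /k (bigD1_seq i) ?iota_uniq ?mem_iota//=.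
  by rewrite leeDl// sume_ge0// => j _; exact: poweR_ge0.
apply/lee_addgt0Pr => e e0.
(* Two losses of e' for each of n sets add up to at most e; n + 1 keeps the denominator positive. *)
pose e' := e / (2 * n.+1%:R); have e'0 : 0 < e' by rewrite divr_gt0// mulr_gt0.
have FP i : {F : set X | [/\ closed F, F `<=` A i & (m (A i `\` F) <= e'%:E)%E]}.
  apply: cid; have [F [ O [cF oO FA AO le]]] :=
    @borel_regular _ _ _ XM m id (fun B bB => hb bB) mT _ (bA i) _ e'0.
  exists F; split => //; apply: le_trans le; apply: le_measure; rewrite ?inE.
  - by apply: measurableD; apply: hb => //; exact: closed_borel.
  - by apply: measurableD; apply: hb; [exact: open_borel|exact: closed_borel].
  - by move=> x [/AO Ox nF].
pose F i := sval (FP i).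
have cF i : closed (F i) by have [] := svalP (FP i).
have FA i : F i `<=` A i by have [] := svalP (FP i).
have Fe i : (m (A i `\` F i) <= e'%:E)%E by have [] := svalP (FP i).
(* The points whose image is within 1/(N+1) of the image of another [F j]. *)
pose O i N := phi @^-1` (\bigcup_(j in [set j | (j < n)%N /\ j != i])
  \bigcup_(y in phi @` F j) (ball y N.+1%:R^-1)°).
have oO i N : open (O i N).
  move/continuousP : cphi; apply; apply: bigcup_open => j _.
  by apply: bigcup_open => y _; exact: open_interior.
have OP i N x : O i N x <-> exists j x', [/\ (j < n)%N, j != i, F j x' &
    mdist (phi x) (phi x') < N.+1%:R^-1].
  split=> [[j [jn ji] [_ [x' Fx' <-] /interior_subset]]|[j [x' [jn ji Fx' xx']]]].
    by rewrite ballEmdist/= metric_sym; exists j, x'.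
  exists j => //; exists (phi x'); first by exists x'.
  have d0 : 0 < N.+1%:R^-1 - mdist (phi x) (phi x') by rewrite subr_gt0.
  apply: filterS (nbhsx_ballx (phi x) _ d0) => y; rewrite !ballEmdist/= => xy.
  apply: le_lt_trans (metric_triangle _ (phi x) _) _.
  by rewrite addrC -ltrBrDr (metric_sym (phi x') (phi x)).
have ndO i N M x : (N <= M)%N -> O i M x -> O i N x.
  move=> NM /OP[j [x' [jn ji Fx' xx']]]; apply/OP; exists j, x'; split => //.
  by apply: lt_le_trans xx' _; rewrite lef_pV2 ?posrE// ler_nat.
(* A point of [F i] lying in [O i N] for every N cannot exist: as psi is continuous, its image has a
   neighbourhood that avoids the images of the other [F j]. So the measure of the intersection tends
   to zero. *)
have NP i : {N | (i < n)%N -> (m (F i `&` O i N) <= e'%:E)%E}.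
  apply: cid; case: (ltnP i n) => ilt; last by exists 0%N.
  have mFO N : measurable (F i `&` O i N : set XM).
    by apply: measurableI; apply: hb; [exact: closed_borel|exact: open_borel].
  have [|N NP] := @nonincreasing_measure_le _ XM _ m (fun N => F i `&` O i N) _ mT e'0 mFO.
    by move=> N M NM; rewrite subsetEset => x [Fx /(ndO _ _ _ _ NM)].
  exists N => _; apply: le_trans NP _.
  rewrite (_ : \bigcap_N _ = set0) ?measure0 ?add0e//.
  rewrite -subset0 => x H; have [Fx _] := H 0%N Logic.I.
  pose U := psi @^-1` (~` \bigcup_(j in [set j | (j < n)%N /\ j != i]) F j).
  have oU : open U.
    move/continuousP : cpsi; apply; apply: closed_openC; apply: closed_bigcup => //.
    by apply: sub_finite_set (finite_II n) => j [].
  have Ux : U (phi x).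
    rewrite /U/= phiK => -[j [jn ji] Fjx]; move/eqP : ji; apply.
    by apply: tA => //; exists x; split; exact: FA.
  have [N0 N0P] := open_invS_ball oU Ux.
  have [_ /OP[j [x' [jn ji Fx' /N0P]]]] := H N0 Logic.I.
  by rewrite /U/= phiK; apply; exists j.
(* One N for all i, as [O i N] shrinks when N grows. The images of the [K i] are then at mutual
   distance at least 1/(N+1) = 4 d. *)
pose N := (\max_(i < n) sval (NP i))%N.
pose K i := F i `\` O i N.
have bK i : borel_set (K i).
  by apply: borel_setD; [exact: closed_borel|exact: open_borel].
pose d : R := N.+1%:R^-1 / 4.
have d0 : 0 < d by rewrite divr_gt0.
have sep i j x y : (i < n)%N -> (j < n)%N -> i != j -> K i x -> K j y ->
    4 * d <= mdist (phi x) (phi y).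
  move=> ilt jlt ij [Fx nOx] [Fy _].
  rewrite leNgt /d mulrC divfK//; apply/negP => lt; apply: nOx; apply/OP.
  by exists j, y; split => //; rewrite eq_sym.
have AK i : (i < n)%N -> (\int[muM]_(x in A i) (g i x `^ q) <=
    \int[muM]_(x in K i) (g i x `^ q) + (e / n.+1%:R)%:E)%E.
  move=> ilt; have mgi : measurable_fun [set: XM] (fun x => g i x `^ q)%E.
    exact: borel_cara_pow.
  have gi0 x : (0 <= g i x `^ q)%E by exact: poweR_ge0.
  have KA : K i `<=` A i by move=> x [/FA].
  rewrite -(setDUK KA) ge0_integral_setU//; last 4 first.
  - exact: hb.
  - by apply: measurableD; exact: hb.
  - exact: measurable_funTS.
  - by apply/disj_setPLR => x Kx [_].
  rewrite leeD2l//; apply: (le_trans (gm i _ ilt (borel_setD (bA i) (bK i)))).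
  apply: (@le_trans _ _ (m (A i `\` F i) + m (F i `&` O i N))%E).
    apply: (@le_trans _ _ (m ((A i `\` F i) `|` (F i `&` O i N)))).
      apply: le_measure; rewrite ?inE.
      - by apply: measurableD; exact: hb.
      - apply: measurableU; first by apply: measurableD; apply: hb => //; exact: closed_borel.
        by apply: measurableI; apply: hb; [exact: closed_borel|exact: open_borel].
      move=> x [Ax nK]; case: (pselect (F i x)) => Fx; last by left.
      by right; split => //; apply: contrapT => nO; apply: nK.
    apply: measureU2.
    - by apply: measurableD; apply: hb => //; exact: closed_borel.
    - by apply: measurableI; apply: hb; [exact: closed_borel|exact: open_borel].
  apply: (@le_trans _ _ (e'%:E + e'%:E)%E); last first.
    by rewrite -EFinD lee_fin /e' invfM mulrA -mulrDl -splitr.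
  apply: leeD => //; apply: le_trans (svalP (NP i) ilt).
  apply: le_measure; rewrite ?inE.
  - by apply: measurableI; apply: hb; [exact: closed_borel|exact: open_borel].
  - by apply: measurableI; apply: hb; [exact: closed_borel|exact: open_borel].
  move=> x [Fx Ox]; split => //; apply: ndO Ox.
  exact: (leq_bigmax (F := fun i : 'I_n => sval (NP i)) (Ordinal ilt)).
apply: (@le_trans _ _ (\sum_(i <- iota 0 n)
    (\int[muM]_(x in K i) (g i x `^ q) + (e / n.+1%:R)%:E))%E).
  rewrite [leLHS]big_seq [leRHS]big_seq.
  apply: lee_sum => i; rewrite mem_iota add0n => /andP[_].
  exact: AK.
rewrite big_split/=; apply: leeD; first exact: separated_sum_le d0 bK sep.
rewrite sumEFin lee_fin big_const_seq count_predT size_iota iter_addr addr0.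
rewrite -[_ *+ n]mulr_natr mulrAC ler_pdivrMr// ler_wpM2l ?(ltW e0)//.
by rewrite ler_nat.
Qed.

(** The sets [max_set] split the integral of the n-th running maximum into pieces on which it is one
    of the [g i], so the bound for disjoint sets holds uniformly in n; monotone convergence
    concludes. *)
Lemma seq_sup_Iq_le : (Iq w <= (C `^ q)%:E)%E.
Proof.
have mr n : measurable_fun [set: XM] (fun x => running_max g n x `^ q)%E.
  by apply: borel_cara_pow => //; exact: borel_running_max.
have r0 n x : (0 <= running_max g n x `^ q)%E by exact: poweR_ge0.
have ndr x : nondecreasing_seq (fun n => running_max g n x `^ q)%E.
  move=> i j ij; apply: le_poweR => //; first exact: running_max_ge0.
  exact: nondecreasing_running_max.
have leC n : (\int[muM]_x (running_max g n x `^ q) <= (C `^ q)%:E)%E.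
  have D := disjoint_sum_le (borel_max_set bg n) (@trivIset_max_set _ _ g n); apply: le_trans D.
  have mb i : measurable (max_set g n i : set XM) by apply: hb; exact: borel_max_set.
  have mg i : measurable_fun [set: XM] (fun x => g i x `^ q)%E by exact: borel_cara_pow.
  under eq_bigr do rewrite integral_mkcond.
  rewrite -ge0_integral_sum//; last 2 first.
  - by move=> i; exact: (measurable_restrictT (T1 := XM) _ (mb i)).1 (measurable_funTS (mg i)).
  - by move=> i x _; apply: erestrict_ge0 => y _; exact: poweR_ge0.
  apply: ge0_le_integral => //.
  - apply: emeasurable_sum => i.
    exact: (measurable_restrictT (T1 := XM) _ (mb i)).1 (measurable_funTS (mg i)).
  (* Where the running maximum vanishes, x need not lie in any [max_set]. *)
  move=> x _; have [/eqP e|] := eqVneq (running_max g n x) 0%E.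
    rewrite (eqP e) poweR0r//; apply: sume_ge0 => i _.
    by apply: erestrict_ge0 => y _; exact: poweR_ge0.
  move=> ne0; have : (0 < running_max g n x)%E by rewrite lt0e ne0 running_max_ge0.
  move=> /max_set_cover[i ilt ix].
  rewrite (bigD1_seq i) ?iota_uniq ?mem_iota//= patchE mem_set//.
  apply: (@le_trans _ _ (g i x `^ q)%E).
    by case: ix => _; apply: le_poweR => //; exact: running_max_ge0.
  rewrite leeDl// sume_ge0// => j _.
  by apply: erestrict_ge0 => y _; exact: poweR_ge0.
have cvg : (\int[muM]_x (running_max g n x `^ q))%E @[n --> \oo] -->
    (\int[muM]_x limn (fun n => running_max g n x `^ q))%E.
  exact: cvg_monotone_convergence.
(* The q-th power commutes with the increasing limit: one inequality is monotonicity, the other is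
   obtained by taking q-th roots. *)
have -> : (Iq w = \int[muM]_x limn (fun n => running_max g n x `^ q))%E.
  apply: eq_integral => x _.
  have cx : cvgn (fun n => running_max g n x `^ q)%E by exact: ereal_nondecreasing_is_cvgn.
  apply/eqP; rewrite eq_le; apply/andP; split; last first.
    apply: lime_le => //; apply/nearW => n; apply: le_poweR => //.
      exact: running_max_ge0.
    by apply: ereal_sup_ubound; exists n.
  have pK (y : \bar R) : (0 <= y)%E -> ((y `^ q^-1) `^ q = y)%E.
    by move=> y0; rewrite -poweRrM mulVf// poweRe1.
  have pK' (y : \bar R) : (0 <= y)%E -> ((y `^ q) `^ q^-1 = y)%E.
    by move=> y0; rewrite -poweRrM mulfV// poweRe1.
  set l := limn _; have l0 : (0 <= l)%E by apply: lime_ge => //; exact: nearW.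
  rewrite -[leRHS]pK//; apply: le_poweR => //.
  apply: ge_ereal_sup => _ [n _ <-].
  rewrite -[leLHS]pK' ?running_max_ge0//.
  apply: gt0_ler_poweR; rewrite ?invr_ge0 ?(ltW q0)// ?in_itv/= ?leey ?poweR_ge0 ?l0//.
  have := ereal_nondecreasing_cvgn (ndr x) => /cvg_lim; rewrite -/l => -> //.
  by apply: ereal_sup_ubound; exists n.
apply: (@cvge_le _ _ _ _ _ _ _ _ cvg); exact: nearW.
Qed.

End norm_bound.
End majorant.
End composition.

(** * Boundedness, Sobolev regularity and the norm identity *)

Theorem theorem1p3 (R : realType)
    (X : pmetricType R) (mu : {outer_measure set X -> \bar R})
    (Y : metricType R) (nu : {outer_measure set Y -> \bar R})
    (hX : is_metric_measure_space mu) (hY : is_metric_measure_space nu)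
    (q : R) (hq : 1 <= q)
    (phi : X -> Y) (hphi : homeomorphism phi) :
  (induces_bounded_composition mu q phi <-> reshetnyak_sobolev mu q phi) /\
  (induces_bounded_composition mu q phi ->
   (composition_norm mu q phi `^ q =
    \int[cara_measure mu]_x (reshetnyak_gradient mu q phi x `^ q))%E).
Proof.
have hb := mms_borel hX.
have [psi [phiK _ cphi cpsi]] := hphi.
(* The image of the base point of X shows that Y is nonempty. *)
have [z dz] := separable_seq (phi point) (mms_separable hY).
have q0 : 0 < q by exact: lt_le_trans hq.
pose g i := min_weak_upper_gradient mu q (fun x => mdist (phi x) (z i)).
pose w := seq_sup g.
have gP (dirv : forall i, dirichlet mu q (fun x => mdist (phi x) (z i))) i :
    is_min_weak_upper_gradient mu q (fun x => mdist (phi x) (z i)) (g i).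
  exact: min_weak_upper_gradientP.
have bw (dirv : forall i, dirichlet mu q (fun x => mdist (phi x) (z i))) : borel_fun w.
  by apply: borel_seq_sup => i; have [[]] := gP dirv i.
have w0 (dirv : forall i, dirichlet mu q (fun x => mdist (phi x) (z i))) x : (0 <= w x)%E.
  by apply: seq_sup_ge0 => i y; have [[_ H _] _ _] := gP dirv i.
have dir_of : induces_bounded_composition mu q phi ->
    forall i, dirichlet mu q (fun x => mdist (phi x) (z i)).
  by move=> [dirL _] i; apply: (dirL (fun y => mdist y (z i))); exists 1; exact: mdist_lip.
have bound : induces_bounded_composition mu q phi ->
    forall C, composition_bound mu q phi C ->
    (\int[cara_measure mu]_x (w x `^ q) <= (C `^ q)%:E)%E.
  move=> ind C bC; apply: (seq_sup_Iq_le hb hq cphi (dir_of ind) bC _ phiK cpsi).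
  by case: ind.
have Lw_of : induces_bounded_composition mu q phi -> Lq_borel mu q w.
  move=> ind; have dirv := dir_of ind; split; [exact: bw|exact: w0|].
  have [_ [C bC]] := ind.
  by apply: le_lt_trans (bound ind C bC) _; exact: ltry.
split; first split.
- move=> ind; split.
    by move=> B bB; apply: hb; exact: continuous_borel_preimage.
  by exists w; have [] := seq_sup_min_majorant hb hq cphi dz (dir_of ind) (Lw_of ind).
- move=> [_ [w' [[mw' fw'] w'0 w'P]]].
  have dirv i : dirichlet mu q (fun x => mdist (phi x) (z i)) by have [] := w'P (z i).
  (* Each [g i] is almost everywhere at most the given majorant w', hence so is w, and w is in
     L^q. *)
  have Lw : Lq_borel mu q w.
    split; [exact: bw|exact: w0|].
    have gw' : \forall x \ae cara_measure mu, forall i, (g i x <= w' x)%E.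
      by apply/ae_foralln => i; have [] := w'P (z i).
    apply: (@le_lt_trans _ _ (\int[cara_measure mu]_x (w' x `^ q))%E); last first.
      exact: (in_Lq_ge0P mu hq w'0).1.
    apply: ae_ge0_le_integral.
    - exact: measurableT.
    - by move=> x _; exact: poweR_ge0.
    - by apply: borel_cara_pow => //; exact: bw.
    - by move=> x _; exact: poweR_ge0.
    - exact: measurableT_comp (measurable_poweR q) mw'.
    move: gw'; apply: ae_mono => x H _; apply: le_poweR => //; first exact: w0.
    by apply: seq_sup_le => // i y; have [[_ H' _] _ _] := gP dirv i.
  split.
    move=> u ul; have := lip_const_ge0 ul => K0.
    by have [] := comp_dirichlet hb hq cphi dz dirv Lw K0 (lip_constP ul).
  by exists (fine ('N[cara_measure mu]_(q%:E)[w])%E); exact: seq_sup_composition_bound.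
move=> ind; have dirv := dir_of ind; have Lw := Lw_of ind.
have minw := seq_sup_min_majorant hb hq cphi dz dirv Lw.
have minG : is_min_reshetnyak_majorant mu q phi (reshetnyak_gradient mu q phi).
  by rewrite /reshetnyak_gradient; exact: (xgetPex (cst +oo%E) (ex_intro _ w minw)).
have [_ _ fw] := Lw.
have Nfin : ('N[cara_measure mu]_(q%:E)[w] \is a fin_num)%E.
  rewrite ge0_fin_numE ?Lnorm_ge0//; exact: (in_Lq_ge0P mu hq (w0 dirv)).2.
(* The L^q norm of w is itself a bound for the operator, and by [bound] no bound is smaller. *)
have -> : composition_norm mu q phi = 'N[cara_measure mu]_(q%:E)[w]%E.
  apply/eqP; rewrite eq_le; apply/andP; split.
    apply: ereal_inf_lbound; exists (fine ('N[cara_measure mu]_(q%:E)[w])%E).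
      exact: seq_sup_composition_bound.
    exact: fineK.
  apply: le_ereal_inf_tmp => _ [C bC <-]; have [C0 _] := bC.
  rewrite (Lnorm_le_EFin mu hq (w0 dirv) C0); exact: bound.
rewrite Lnorm_powq//; last exact: w0.
(* Both w and [reshetnyak_gradient] are least majorants, so each is almost everywhere at most the
   other and the integrals agree. *)
have [[[mG fG] G0 _] Gle] := minG; have [wmaj wle] := minw.
apply/eqP; rewrite eq_le; apply/andP; split.
  apply: ae_ge0_le_integral.
  - exact: measurableT.
  - by move=> x _; exact: poweR_ge0.
  - by apply: borel_cara_pow => //; exact: bw.
  - by move=> x _; exact: poweR_ge0.
  - exact: measurableT_comp (measurable_poweR q) mG.
  by have := wle _ (proj1 minG); apply: ae_mono => x H _; apply: le_poweR => //; exact: w0.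
apply: ae_ge0_le_integral.
- exact: measurableT.
- by move=> x _; exact: poweR_ge0.
- exact: measurableT_comp (measurable_poweR q) mG.
- by move=> x _; exact: poweR_ge0.
- by apply: borel_cara_pow => //; exact: bw.
by have := Gle _ wmaj; apply: ae_mono => x H _; apply: le_poweR => //; exact: G0.
Qed.
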